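(* Let $n\ge 3$ and let $v$ be a positive solution of $a^{ij}(x)v_{ij}=0$ in $\mathbb{R}^n\setminus\overline{B}_1$, where $a^{ij}(x)$ is uniformly elliptic and $a^{ij}(x)\to a^{ij}_\infty$ as $|x|\to\infty$. Then there exists a constant $v_\infty$ such that $$v(x)=v_\infty+o\left(\frac{1}{|x|^{n-2-\delta}}\right)\quad\text{as }|x|\to\infty,\ \text{for all }\delta>0.$$ Furthermore, if in addition $$|a^{ij}(x)-a^{ij}_\infty|\le\frac{C}{|x|^{\alpha}}\quad(x\in\mathbb{R}^n\setminus B_1)$$ for some positive constants $C$ and $\alpha$, then $$v(x)=v_\infty+O\left(\frac{1}{|x|^{n-2}}\right)\quad\text{as }|x|\to\infty.$$
   Context: $B_1$ is the open unit ball of $\mathbb{R}^n$ centered at the origin. Repeated indices are summed from $1$ to $n$, and $v_{ij}=\partial_{x_i}\partial_{x_j}v$. The coefficient matrix $(a^{ij}(x))$ is real symmetric, and uniformly elliptic means that there are constants $0<\lambda\le\Lambda$ with $\lambda|\xi|^2\le a^{ij}(x)\xi_i\xi_j\le\Lambda|\xi|^2$ for all $x$ and all $\xi\in\mathbb{R}^n$; $(a_\infty^{ij})$ is a constant matrix. Solutions are understood in the classical sense. *)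

(* Defs.v *)
From HB Require Import structures.
From mathcomp Require Export all_boot all_order all_algebra.
From mathcomp Require Export all_classical all_reals all_analysis.
Export Order.TTheory GRing.Theory Num.Theory.
Export numFieldNormedType.Exports.

Set Implicit Arguments.
Unset Strict Implicit.
Unset Printing Implicit Defensive.

Local Open Scope classical_set_scope.
Local Open Scope ring_scope.

(* Euclidean norm; the library's norm on row vectors is the sup norm, which
   induces the same topology. *)
Definition enorm (R : realType) (n : nat) (x : 'rV[R]_n) : R :=
  Num.sqrt (\sum_(i < n) x ord0 i ^+ 2).

Definition unit_ball {R : realType} {n : nat} : set 'rV[R]_n :=
  [set x | enorm x < 1].

Definition closed_unit_ball {R : realType} {n : nat} : set 'rV[R]_n :=
  [set x | enorm x <= 1].

(* The filter "|x| --> oo". *)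
Definition at_infinity {R : realType} {n : nat} : set_system 'rV[R]_n :=
  filter_from [set: R] (fun M => [set x : 'rV[R]_n | M < enorm x]).

Global Instance at_infinity_filter (R : realType) (n : nat) :
  Filter (@at_infinity R n).
Proof.
apply: filter_from_filter; first by exists 0.
move=> M N _ _; exists (Num.max M N) => // x /=.
by rewrite gt_max => /andP[].
Qed.

Canonical at_infinity_filterType (R : realType) (n : nat) :=
  FilterType (@at_infinity R n) (@at_infinity_filter R n).

Definition partial (R : realType) (n : nat) (i : 'I_n) (f : 'rV[R]_n -> R) :
    'rV[R]_n -> R :=
  fun x => 'D_(delta_mx ord0 i) f x.

Definition has_partial (R : realType) (n : nat) (i : 'I_n)
    (f : 'rV[R]_n -> R) (x : 'rV[R]_n) : Prop :=
  derivable f x (delta_mx ord0 i).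

(* Class C^2 on D; meant for open D, so that partial derivatives at a point
   of D only depend on the values of f in D. *)
Definition C2_on (R : realType) (n : nat) (D : set 'rV[R]_n)
    (f : 'rV[R]_n -> R) : Prop :=
  forall x, D x ->
    [/\ {for x, continuous f},
        forall i, has_partial i f x /\ {for x, continuous (partial i f)} &
        forall i j, has_partial i (partial j f) x /\
          {for x, continuous (partial i (partial j f))}].

Definition symmetric_on (R : realType) (n : nat) (D : set 'rV[R]_n)
    (a : 'rV[R]_n -> 'M[R]_n) : Prop :=
  forall x, D x -> (a x)^T = a x.

Definition uniformly_elliptic_on (R : realType) (n : nat) (D : set 'rV[R]_n)
    (a : 'rV[R]_n -> 'M[R]_n) : Prop :=
  exists lambda Lambda : R, [/\ 0 < lambda, lambda <= Lambda &
    forall x, D x -> forall xi : 'rV[R]_n,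
      lambda * enorm xi ^+ 2
        <= \sum_(i < n) \sum_(j < n) a x i j * xi ord0 i * xi ord0 j
        <= Lambda * enorm xi ^+ 2].

Definition classical_solution (R : realType) (n : nat) (D : set 'rV[R]_n)
    (a : 'rV[R]_n -> 'M[R]_n) (v : 'rV[R]_n -> R) : Prop :=
  C2_on D v /\
  forall x, D x ->
    \sum_(i < n) \sum_(j < n) a x i j * partial i (partial j v) x = 0.

(* Main.v *)
Require Import Defs.
From mathcomp Require Import ring lra.

(* Near infinity the operator is, after a linear change of variables, a small
   perturbation of the Laplacian. For such operators a Harnack inequality has
   an elementary proof. The coupling by reflection (Ishii-Lions), applied at a
   maximum point of u(x) - u(z) - K|x - z|^(1/2) - L|x - y|^2, shows that u is
   Hoelder continuous at y with a constant depending only on its bound on a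
   ball around y. Used at a maximum point y of (rho - |x - c|)^(n-1) u(x), it
   gives u >= u(y)/2 on a ball of comparable size, and the barrier
   |x - y|^(1-n) spreads this bound out. The barrier 1 - (r/|x|)^(1/2) shows
   that liminf v is finite; Harnack on spheres, applied to v - liminf v + e,
   together with the maximum principle between spheres turns the liminf into a
   limit. The rates follow by comparing the difference from the limit with
   |x|^-(n-2-d), respectively with |x|^-(n-2) - |x|^-(n-2)-alpha/2. *)

Set Implicit Arguments.
Unset Strict Implicit.
Unset Printing Implicit Defensive.

Local Open Scope classical_set_scope.
Local Open Scope ring_scope.

(** * Second symmetric differences *)

(** The coefficients carry no regularity, only closeness to a constant matrix, and this dictates the
    normal form [near_laplace]. A perturbation of unknown sign is absorbed by giving up a small
    multiple of the limit matrix: the remainder is then positive semidefinite and factors as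
    [S^T S]. The operator becomes a sum of second derivatives along the coordinate directions and
    along the rows of [S], all with nonnegative weight, so every maximum argument tests one line at
    a time and adds up the inequalities. Second derivatives therefore enter only as symmetric
    (Schwarz) differences along lines, which is [sdiff2]. Two scalings matter. In the Harnack
    argument the weight and the barrier have the same exponent n-1, so the uncontrolled distance of
    the maximum point from the boundary cancels and the constant depends on n alone. And the bound
    on [S] is linear in the deviation of the coefficients, so a power rate for the coefficients
    becomes the same power rate for [eta]. *)

Definition sdiff2 (R : realType) (g : R -> R) (h : R) : Prop :=
  forall e : R, 0 < e -> exists2 d : R, 0 < d &
    forall t, 0 < t -> t < d ->
      `|g t + g (- t) - 2 * g 0 - h * t ^+ 2| <= e * t ^+ 2.

Lemma sdiff2D (R : realType) (g1 g2 : R -> R) (h1 h2 : R) :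
  sdiff2 g1 h1 -> sdiff2 g2 h2 -> sdiff2 (fun t => g1 t + g2 t) (h1 + h2).
Proof.
move=> s1 s2 e e0; have e20 : 0 < e / 2 by rewrite divr_gt0.
have [d1 d10 H1] := s1 _ e20; have [d2 d20 H2] := s2 _ e20.
exists (Num.min d1 d2); first by rewrite lt_min d10.
move=> t t0; rewrite lt_min => /andP[t1 t2].
have := H1 _ t0 t1; have := H2 _ t0 t2; rewrite !ler_norml; lra.
Qed.

Lemma sdiff2Z (R : realType) (c : R) (g : R -> R) (h : R) :
  sdiff2 g h -> sdiff2 (fun t => c * g t) (c * h).
Proof.
move=> s e e0; have c0 : 0 < `|c| + 1 by rewrite ltr_wpDl.
have [|d d0 H] := s (e / (`|c| + 1)); first by rewrite divr_gt0.
exists d => // t t0 td.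
rewrite (_ : _ - _ = c * (g t + g (- t) - 2 * g 0 - h * t ^+ 2)); last by ring.
rewrite normrM; apply: le_trans (ler_wpM2l (normr_ge0 c) (H _ t0 td)) _.
rewrite mulrA ler_wpM2r ?sqr_ge0// mulrCA ger_pMr//.
by rewrite ler_pdivrMr// mul1r lerDl.
Qed.

Lemma sdiff2N (R : realType) (g : R -> R) (h : R) :
  sdiff2 g h -> sdiff2 (fun t => - g t) (- h).
Proof.
move=> /(sdiff2Z (-1)); rewrite mulN1r => s e /s[d d0 H].
by exists d => // t t0 /(H _ t0); rewrite !mulN1r.
Qed.

Lemma sdiff2B (R : realType) (g1 g2 : R -> R) (h1 h2 : R) :
  sdiff2 g1 h1 -> sdiff2 g2 h2 -> sdiff2 (fun t => g1 t - g2 t) (h1 - h2).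
Proof. by move=> s1 /sdiff2N; exact: sdiff2D. Qed.

Lemma sdiff2_cst (R : realType) (c : R) : sdiff2 (fun=> c) 0.
Proof.
move=> e e0; exists 1 => // t t0 _.
by rewrite (_ : _ - _ = 0) ?normr0 ?mulr_ge0 ?sqr_ge0 ?ltW//; ring.
Qed.

Lemma sdiff2_le0 (R : realType) (g : R -> R) (h : R) : sdiff2 g h ->
  (exists2 d, 0 < d & forall t, `|t| < d -> g t <= g 0) -> h <= 0.
Proof.
move=> s [d d0 gd]; rewrite leNgt; apply/negP => h0.
have [|r r0 H] := s (h / 2); first by rewrite divr_gt0.
pose t := Num.min d r / 2.
have m0 : 0 < Num.min d r by rewrite lt_min d0.
have t0 : 0 < t by rewrite divr_gt0.
have tm : t < Num.min d r by rewrite /t; lra.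
move: (tm); rewrite lt_min => /andP[td tr].
have := H _ t0 tr; have := gd t; have := gd (- t).
rewrite normrN gtr0_norm// => /(_ td) g1 /(_ td) g2.
have p : 0 < h * t ^+ 2 by rewrite mulr_gt0// exprn_gt0.
rewrite ler_norml; lra.
Qed.

(** Serves twice: with [d = 0] on a symmetrized function, and on one leg of a path parallel to the
    axes, with [d] the partial derivative at the base point. The sign of [a] is free, hence the
    symmetric ranges for [s]. *)
Lemma MVT_le (R : realType) (g dg : R -> R) (a d e : R) :
  (forall s : R, `|s| <= `|a| -> is_derive s 1 g (dg s)) ->
  (forall s, `|s| <= `|a| -> `|dg s - d| <= e) ->
  `|g a - g 0 - a * d| <= e * `|a|.
Proof.
move=> gd gb.
have cg x y : x <= y -> `|x| <= `|a| -> `|y| <= `|a| ->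
    {within `[x, y], continuous g}.
  move=> xy xa ya; apply: continuous_in_subspaceT => s.
  rewrite inE/= in_itv/= => /andP[xs sy].
  have /gd /@ex_derive/derivable1_diffP/differentiable_continuous// : `|s| <= `|a|.
  by move: xa ya; rewrite !ler_norml; lra.
have [a0|a0|->] := ltgtP a 0; last first.
- by rewrite subrr mul0r subrr normr0 mulr0.
- have [||c] := @MVT R g dg 0 a a0; last first.
  + rewrite in_itv/= => /andP[c0 ca] ->.
    rewrite subr0 mulrC -mulrBr normrM mulrC ler_wpM2r// gb//.
    by rewrite !gtr0_norm// ltW.
  + by apply: cg; rewrite ?normr0// ltW.
  + move=> s; rewrite in_itv/= => /andP[c0 ca]; apply: gd.
    by rewrite !gtr0_norm// ltW.
- have [||c] := @MVT R g dg a 0 a0; last first.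
  + rewrite in_itv/= => /andP[c0 ca] E.
    rewrite (_ : _ - _ = - a * - (dg c - d)); last first.
      by move: E; rewrite sub0r => E; apply/eqP; rewrite -subr_eq0; apply/eqP; lra.
    rewrite normrM !normrN mulrC ler_wpM2r// gb//.
    by rewrite !ltr0_norm// lerN2 ltW.
  + by apply: cg; rewrite ?normr0// ltW.
  + move=> s; rewrite in_itv/= => /andP[c0 ca]; apply: gd.
    by rewrite !ltr0_norm// lerN2 ltW.
Qed.

(** Multiplying out the difference quotient admits [h = 0] and gives a form that can be translated
    along a line and summed over coordinates. *)
Lemma is_derive_eps (R : realType) (g : R -> R) (x d : R) :
  is_derive x 1 g d <->
  (forall e : R, 0 < e -> exists2 r : R, 0 < r & forall h : R, `|h| < r ->
     `|g (x + h) - g x - h * d| <= e * `|h|).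
Proof.
apply: (@iff_trans _ (h^-1 * (g (x + h) - g x) @[h --> 0^'] --> d)).
  have E : (fun h : R => h^-1 *: ((g \o shift x) (h *: (1 : R)) - g x)) =
      (fun h => h^-1 * (g (x + h) - g x)).
    by apply/funext => h; rewrite /= -[h *: 1]/(h * 1) mulr1 (addrC h).
  split=> [[]|H].
    rewrite /derivable /derive E.  move=> /cvg_ex[l gl].
    by have -> := cvg_lim _ gl => //; move=> <-.
  split; first by rewrite /derivable E; apply/cvg_ex; exists d.
  by rewrite /derive E; exact: cvg_lim.
have Eh h : h != 0 -> d - h^-1 * (g (x + h) - g x) =
    - (g (x + h) - g x - h * d) / h by move=> h0; field.
split=> [/cvgrPdist_le H e /H|H].
  rewrite /dnbhs near_withinE => /nbhs_ballP[r /= r0 {}H]; exists r => // h hr.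
  have [->|h0] := eqVneq h 0; first by rewrite addr0 subrr mul0r subrr normr0 mulr0.
  have := H h; rewrite /ball/= sub0r normrN => /(_ hr h0).
  by rewrite Eh// normrM normrN normfV ler_pdivrMr ?normr_gt0.
apply/cvgrPdist_le => e /H[r r0 {}H]; rewrite /dnbhs near_withinE.
apply/nbhs_ballP; exists r => //= h; rewrite /ball/= sub0r normrN => hr h0.
by rewrite Eh// normrM normrN normfV ler_pdivrMr ?normr_gt0// H.
Qed.

(** The function [k s = g s + g (- s) - h s^2] has derivative [dg s - dg (- s) - 2 h s], which is
    o(s) by derivability of [dg] at 0 alone. The mean value theorem then gives
    [k t - k 0 = o(t^2)]. *)
Lemma sdiff2_is_derive (R : realType) (g dg : R -> R) (h r : R) : 0 < r ->
  (forall t : R, `|t| < r -> is_derive t 1 g (dg t)) ->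
  is_derive (0 : R) 1 dg h -> sdiff2 g h.
Proof.
move=> r0 gd /is_derive_eps dgd e e0.
have [|d d0 H] := dgd (e / 2); first by rewrite divr_gt0.
exists (Num.min r d); first by rewrite lt_min r0.
move=> t t0; rewrite lt_min => /andP[tr td].
pose k s := g s + g (- s) - h * s ^+ 2.
have := @MVT_le _ k (fun s => dg s - dg (- s) - h * (2 * s)) t 0 (e * t).
have -> : k t - k 0 - t * 0 = g t + g (- t) - 2 * g 0 - h * t ^+ 2.
  by rewrite /k oppr0; ring.
rewrite gtr0_norm// -mulrA -expr2; apply => s st.
  have sr : `|s| < r by apply: le_lt_trans tr.
  have g1 := gd s sr.
  have g2 : is_derive (- s) 1 g (dg (- s)) by apply: gd; rewrite normrN.
  have g3 : is_derive s 1 (g \o -%R) (dg (- s) * -1).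
    by apply: is_derive1_comp.
  have -> : k = (fun s => g s + (g \o -%R) s - h * (s * s)).
    by apply/funext => y; rewrite /k expr2.
  apply: is_derive_eq; rewrite /GRing.scale/=; ring.
rewrite subr0 (_ : _ - _ - _ = (dg (0 + s) - dg 0 - s * h) -
   (dg (0 - s) - dg 0 - (- s) * h)); last by rewrite add0r sub0r; ring.
have sd' : `|s| < d by apply: le_lt_trans td.
apply: le_trans (ler_normB _ _) _.
have -> : e * t = e / 2 * t + e / 2 * t by field.
apply: lerD; (apply: le_trans (H _ _) _; first by rewrite ?normrN);
  by rewrite ?normrN ler_wpM2l// divr_ge0// ltW.
Qed.

(** * Euclidean norm *)

Definition dotr (R : realType) (n : nat) (x y : 'rV[R]_n) : R :=
  (x *m y^T) ord0 ord0.

Definition nsq (R : realType) (n : nat) (x : 'rV[R]_n) : R := dotr x x.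

Definition qf (R : realType) (n : nat) (H : 'M[R]_n) (w : 'rV[R]_n) : R :=
  (w *m H *m w^T) ord0 ord0.

Lemma dotrE (R : realType) (n : nat) (x y : 'rV[R]_n) :
  dotr x y = \sum_i x ord0 i * y ord0 i.
Proof. by rewrite /dotr mxE; apply: eq_bigr => i _; rewrite mxE. Qed.

Lemma qfE (R : realType) (n : nat) (H : 'M[R]_n) (w : 'rV[R]_n) :
  qf H w = \sum_i \sum_j H i j * w ord0 i * w ord0 j.
Proof.
rewrite /qf mxE exchange_big/=; apply: eq_bigr => j _.
by rewrite !mxE mulr_suml; apply: eq_bigr => i _; rewrite (mulrC (H i j)).
Qed.

Lemma dotrC (R : realType) (n : nat) (x y : 'rV[R]_n) : dotr x y = dotr y x.
Proof. by rewrite !dotrE; apply: eq_bigr => i _; rewrite mulrC. Qed.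

Lemma dotrDl (R : realType) (n : nat) (x y z : 'rV[R]_n) :
  dotr (x + y) z = dotr x z + dotr y z.
Proof. by rewrite /dotr mulmxDl mxE. Qed.

Lemma dotrZl (R : realType) (n : nat) (c : R) (x z : 'rV[R]_n) :
  dotr (c *: x) z = c * dotr x z.
Proof. by rewrite /dotr -scalemxAl mxE. Qed.

Lemma dotrDr (R : realType) (n : nat) (x y z : 'rV[R]_n) :
  dotr z (x + y) = dotr z x + dotr z y.
Proof. by rewrite dotrC dotrDl !(dotrC z). Qed.

Lemma dotrZr (R : realType) (n : nat) (c : R) (x z : 'rV[R]_n) :
  dotr z (c *: x) = c * dotr z x.
Proof. by rewrite dotrC dotrZl (dotrC z). Qed.

Lemma dotrNl (R : realType) (n : nat) (x z : 'rV[R]_n) :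
  dotr (- x) z = - dotr x z.
Proof. by rewrite -scaleN1r dotrZl mulN1r. Qed.

Lemma dotrNr (R : realType) (n : nat) (x z : 'rV[R]_n) :
  dotr z (- x) = - dotr z x.
Proof. by rewrite -scaleN1r dotrZr mulN1r. Qed.

Definition dotr_simp := (dotrDl, dotrDr, dotrZl, dotrZr, dotrNl, dotrNr).

Lemma nsq_line (R : realType) (n : nat) (x w : 'rV[R]_n) (t : R) :
  nsq (x + t *: w) = nsq x + 2 * t * dotr x w + t ^+ 2 * nsq w.
Proof. by rewrite /nsq !dotr_simp (dotrC w x); ring. Qed.

Lemma nsqZ (R : realType) (n : nat) (c : R) (x : 'rV[R]_n) :
  nsq (c *: x) = c ^+ 2 * nsq x.
Proof. by rewrite /nsq !dotr_simp mulrA. Qed.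

Lemma nsqN (R : realType) (n : nat) (x : 'rV[R]_n) : nsq (- x) = nsq x.
Proof. by rewrite /nsq !dotr_simp opprK. Qed.

Lemma nsq0 (R : realType) (n : nat) : nsq (0 : 'rV[R]_n) = 0.
Proof. by rewrite -(scale0r (0 : 'rV[R]_n)) nsqZ expr0n mul0r. Qed.

Lemma nsqE (R : realType) (n : nat) (x : 'rV[R]_n) :
  nsq x = \sum_i x ord0 i ^+ 2.
Proof. exact: dotrE. Qed.

Lemma nsq_ge0 (R : realType) (n : nat) (x : 'rV[R]_n) : 0 <= nsq x.
Proof. by rewrite nsqE sumr_ge0// => i _; exact: sqr_ge0. Qed.

Lemma nsq_eq0 (R : realType) (n : nat) (x : 'rV[R]_n) : (nsq x == 0) = (x == 0).
Proof.
apply/eqP/eqP => [|->]; last exact: nsq0.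
rewrite nsqE => /eqP; rewrite psumr_eq0; last by move=> i _; exact: sqr_ge0.
move=> /allP x0; apply/rowP => i; rewrite mxE.
by apply/eqP; rewrite -sqrf_eq0; apply: x0; rewrite mem_index_enum.
Qed.

Lemma nsq_gt0 (R : realType) (n : nat) (x : 'rV[R]_n) : (0 < nsq x) = (x != 0).
Proof. by rewrite lt_def nsq_ge0 nsq_eq0 andbT. Qed.

Lemma enormE (R : realType) (n : nat) (x : 'rV[R]_n) : enorm x = Num.sqrt (nsq x).
Proof. by rewrite nsqE. Qed.

Lemma enorm_ge0 (R : realType) (n : nat) (x : 'rV[R]_n) : 0 <= enorm x.
Proof. exact: sqrtr_ge0. Qed.

Lemma enorm_sqr (R : realType) (n : nat) (x : 'rV[R]_n) : enorm x ^+ 2 = nsq x.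
Proof. by rewrite enormE sqr_sqrtr// nsq_ge0. Qed.

Lemma enormZ (R : realType) (n : nat) (c : R) (x : 'rV[R]_n) :
  enorm (c *: x) = `|c| * enorm x.
Proof. by rewrite !enormE nsqZ sqrtrM ?sqr_ge0// sqrtr_sqr. Qed.

Lemma enormN (R : realType) (n : nat) (x : 'rV[R]_n) : enorm (- x) = enorm x.
Proof. by rewrite !enormE nsqN. Qed.

Lemma enorm0 (R : realType) (n : nat) : enorm (0 : 'rV[R]_n) = 0.
Proof. by rewrite enormE nsq0 sqrtr0. Qed.

Lemma enormC (R : realType) (n : nat) (x y : 'rV[R]_n) :
  enorm (x - y) = enorm (y - x).
Proof. by rewrite -enormN opprB. Qed.

Lemma enorm_gt0 (R : realType) (n : nat) (x : 'rV[R]_n) : (0 < enorm x) = (x != 0).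
Proof. by rewrite enormE sqrtr_gt0 nsq_gt0. Qed.

(** Cauchy-Schwarz: the squared length of [nsq y *: x - dotr x y *: y] is [nsq y] times the
    difference of the two sides. *)
Lemma dotr_sqr_le (R : realType) (n : nat) (x y : 'rV[R]_n) :
  dotr x y ^+ 2 <= nsq x * nsq y.
Proof.
have [->|y0] := eqVneq y 0.
  by rewrite -(scale0r (0 : 'rV[R]_n)) dotrZr mul0r expr0n mulr_ge0 ?nsq_ge0.
rewrite -subr_ge0 -(pmulr_rge0 _ (_ : 0 < nsq y)) ?nsq_gt0//.
have := nsq_ge0 (nsq y *: x + (- dotr x y) *: y).
by rewrite nsq_line nsqZ !dotr_simp; congr (0 <= _); rewrite /nsq; ring.
Qed.

Lemma dotr_le (R : realType) (n : nat) (x y : 'rV[R]_n) :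
  `|dotr x y| <= enorm x * enorm y.
Proof.
rewrite -(@ler_pXn2r _ 2) ?nnegrE ?mulr_ge0 ?enorm_ge0//.
by rewrite exprMn !enorm_sqr real_normK ?num_real// dotr_sqr_le.
Qed.

Lemma enormD (R : realType) (n : nat) (x y : 'rV[R]_n) :
  enorm (x + y) <= enorm x + enorm y.
Proof.
rewrite -(@ler_pXn2r _ 2) ?nnegrE ?addr_ge0 ?enorm_ge0//.
rewrite sqrrD !enorm_sqr; have := nsq_line x y 1.
have := ler_norm (dotr x y); have := dotr_le x y.
rewrite scale1r; lra.
Qed.

Lemma enorm_triangle (R : realType) (n : nat) (x y z : 'rV[R]_n) :
  enorm (x - z) <= enorm (x - y) + enorm (y - z).
Proof. by rewrite -[x - z](subrKA y); exact: enormD. Qed.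

Lemma enorm_coord (R : realType) (n : nat) (x : 'rV[R]_n) i :
  `|x ord0 i| <= enorm x.
Proof.
rewrite -(@ler_pXn2r _ 2) ?nnegrE ?enorm_ge0// enorm_sqr nsqE.
rewrite real_normK ?num_real// (bigD1 i)//= lerDl sumr_ge0// => j _.
exact: sqr_ge0.
Qed.

Lemma mx_norm_le_enorm (R : realType) (n : nat) (x : 'rV[R]_n) : `|x| <= enorm x.
Proof.
rewrite [leLHS]/Num.norm/= mx_normrE; apply/bigmax_leP; split.
  exact: enorm_ge0.
by move=> [i j] _ /=; rewrite ord1; exact: enorm_coord.
Qed.

Lemma cvg_sumr (R : realType) (T I : Type) (F : set_system T) (r : seq I)
    (f : I -> T -> R) (a : I -> R) : Filter F ->
  (forall i, f i x @[x --> F] --> a i) ->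
  \sum_(i <- r) f i x @[x --> F] --> \sum_(i <- r) a i.
Proof.
move=> FF fa; elim: r => [|i r IH].
  by rewrite big_nil; under eq_cvg do rewrite big_nil; exact: cvg_cst.
by rewrite big_cons; under eq_cvg do rewrite big_cons; exact: cvgD.
Qed.

Lemma nsq_continuous (R : realType) (n : nat) : continuous (@nsq R n).
Proof.
move=> x; rewrite (_ : @nsq R n = fun y => \sum_(i < n) y ord0 i * y ord0 i).
  apply: (@cvg_sumr _ _ _ (nbhs x) _ _ _ (nbhs_filter x)) => i.
  by apply: cvgM; exact: coord_continuous.
by apply/funext => y; rewrite nsqE.
Qed.

Lemma enorm_continuous (R : realType) (n : nat) : continuous (@enorm R n).
Proof.
rewrite (_ : @enorm R n = Num.sqrt \o @nsq R n).
  by move=> x; apply: continuous_comp;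
    [exact: nsq_continuous|exact: sqrt_continuous].
by apply/funext => y; rewrite enormE.
Qed.

Lemma enormB_continuous (R : realType) (n : nat) (c : 'rV[R]_n) :
  continuous (fun x : 'rV[R]_n => enorm (x - c)).
Proof.
move=> x; apply: (@continuous_comp _ _ _ (fun x : 'rV[R]_n => x - c) (@enorm R n)).
  apply: (@cvgB _ _ _ (nbhs x)); [exact: cvg_id|exact: cvg_cst].
exact: enorm_continuous.
Qed.

Lemma near_enorm_lt (R : realType) (n : nat) (x c : 'rV[R]_n) (r : R) :
  enorm (x - c) < r -> \forall y \near x, enorm (y - c) < r.
Proof. exact: (cvgr_lt _ (@enormB_continuous R n c x)). Qed.

Lemma near_enorm_gt (R : realType) (n : nat) (x c : 'rV[R]_n) (r : R) :
  r < enorm (x - c) -> \forall y \near x, r < enorm (y - c).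
Proof. exact: (cvgr_gt _ (@enormB_continuous R n c x)). Qed.

Lemma compact_annulus (R : realType) (n : nat) (c d : 'rV[R]_n) (r s : R) :
  compact [set x : 'rV[R]_n | r <= enorm (x - c) /\ enorm (x - d) <= s].
Proof.
apply: bounded_closed_compact.
  exists (s + enorm d); split; first exact: num_real.
  move=> M sM x /= [_ xs]; apply: le_trans (mx_norm_le_enorm _) _.
  apply: le_trans (ltW sM); rewrite -[x](subrK d).
  by apply: le_trans (enormD _ _) _; rewrite lerD2r.
rewrite (_ : mkset _ = (fun x : 'rV[R]_n => enorm (x - c)) @^-1` [set y | r <= y] `&`
   (fun x : 'rV[R]_n => enorm (x - d)) @^-1` [set y | y <= s])//.
apply: closedI; (apply: closed_comp => [x _|]; first exact: enormB_continuous).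
  exact: closed_ge.
exact: closed_le.
Qed.

Lemma near_line (R : realType) (n : nat) (P : set 'rV[R]_n) (x w : 'rV[R]_n) :
  (\forall y \near x, P y) ->
  exists2 d : R, 0 < d & forall t : R, `|t| < d -> P (x + t *: w).
Proof.
move=> Px; have : \forall t \near (0 : R), P (x + t *: w).
  have : x + t *: w @[t --> (0 : R)] --> x + 0 *: w.
    by apply: cvgD; [exact: cvg_cst|apply: cvgZr_tmp => //; exact: cvg_id].
  rewrite scale0r addr0; exact.
move=> /nbhs_ballP[d d0 H]; exists d => // t td; apply: H.
by rewrite /ball/= sub0r normrN.
Qed.

(** * Directional derivatives and positive semidefinite matrices *)

Lemma is_derive_line (R : realType) (n : nat) (f : 'rV[R]_n -> R)
    (x w : 'rV[R]_n) (t d : R) :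
  is_derive (0 : R) 1 (fun s : R => f (x + t *: w + s *: w)) d ->
  is_derive t 1 (fun s : R => f (x + s *: w)) d.
Proof.
move=> /is_derive_eps H; apply/is_derive_eps => e /H[r r0 {}H].
by exists r => // h /H; rewrite add0r scale0r addr0 scalerDl addrA.
Qed.

Lemma has_partial_line (R : realType) (n : nat) (i : 'I_n) (f : 'rV[R]_n -> R)
    (x : 'rV[R]_n) (t : R) : has_partial i f (x + t *: delta_mx ord0 i) ->
  is_derive t 1 (fun s : R => f (x + s *: delta_mx ord0 i))
    (partial i f (x + t *: delta_mx ord0 i)).
Proof.
move=> fx; apply: is_derive_line; move: (x + _) fx => {t}x fx.
have E : (fun h : R => h^-1 *: (((fun s : R => f (x + s *: delta_mx ord0 i)) \o
    shift (0 : R)) (h *: (1 : R)) - f (x + (0 : R) *: delta_mx ord0 i))) =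
  (fun h : R => h^-1 *: ((f \o shift x) (h *: delta_mx ord0 i) - f x)).
  apply/funext => h; congr (_ *: (_ - _)); rewrite /= ?scale0r ?addr0//.
  by rewrite -[h *: 1]/(h * 1) mulr1 addrC.
by split; rewrite /partial /derivable /derive E.
Qed.

(** The points [x + trunc k h] are the corners of a path from [x] to [x + h] whose legs are parallel
    to the axes. *)
Definition trunc (R : realType) (n : nat) (k : nat) (h : 'rV[R]_n) : 'rV[R]_n :=
  \row_j (if (j < k)%N then h ord0 j else 0).

Lemma truncS (R : realType) (n : nat) (i : 'I_n) (h : 'rV[R]_n) :
  trunc i.+1 h = trunc i h + h ord0 i *: delta_mx ord0 i.
Proof.
apply/rowP => j; rewrite !mxE eqxx/= ltnS leq_eqVlt.
have [->|ji] := eqVneq j i; first by rewrite eqxx ltnn mulr1 add0r.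
by rewrite (negbTE (_ : nat_of_ord j != i))//= mulr0 addr0.
Qed.

Lemma partials_line (R : realType) (n : nat) (f : 'rV[R]_n -> R)
    (x w : 'rV[R]_n) :
  (\forall y \near x, forall i, has_partial i f y) ->
  (forall i, {for x, continuous (partial i f)}) ->
  is_derive (0 : R) 1 (fun t : R => f (x + t *: w))
    (\sum_i w ord0 i * partial i f x).
Proof.
move=> fd fc; apply/is_derive_eps => e e0.
(* [B] dominates each coordinate of [w], which keeps the whole path in the sup-norm ball of radius
   [r], and also their sum, which turns the error [e / B] per unit of length into [e]. *)
pose B := 1 + \sum_i `|w ord0 i|.
have B0 : 0 < B by rewrite ltr_pwDl// sumr_ge0.
have eB : 0 < e / B by rewrite divr_gt0.
have near_c : \forall y \near x, forall i, `|partial i f y - partial i f x| <= e / B.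
  apply: (@filter_forall _ _ (fun i y => `|partial i f y - partial i f x| <= e / B)
    (nbhs x) (nbhs_filter x)) => i.
  have /cvgrPdist_le/(_ _ eB) := fc i.
  by apply: filterS => y; rewrite distrC.
have : nbhs x [set y | (forall i, has_partial i f y) /\
    (forall i, `|partial i f y - partial i f x| <= e / B)].
  exact: (@filterI _ (nbhs x) (nbhs_filter x) _ _ fd near_c).
move=> /nbhs_ballP[r /= r0 {near_c}H].
exists (r / B); first by rewrite divr_gt0.
move=> t tr; rewrite add0r scale0r addr0.
have trB : `|t| * B < r by rewrite -ltr_pdivlMr.
pose h := t *: w.
have hr i : `|h ord0 i| < r.
  apply: le_lt_trans trB; rewrite mxE normrM ler_wpM2l//.
  by rewrite /B (bigD1 i)//= addrCA lerDl addr_ge0// sumr_ge0.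
have Hk k : (k <= n)%N ->
    `|f (x + trunc k h) - f x - \sum_(i < n | (i < k)%N) h ord0 i * partial i f x|
    <= e / B * \sum_(i < n | (i < k)%N) `|h ord0 i|.
  elim: k => [_|k IH kn].
    rewrite !big_pred0// (_ : trunc 0 h = 0) ?addr0 ?subrr ?subr0 ?normr0 ?mulr0//.
    by apply/rowP => j; rewrite !mxE.
  pose i := Ordinal kn.
  rewrite (bigD1 i)//= [X in _ <= _ * X](bigD1 i)//=.
  have P (j : 'I_n) : (j < k.+1)%N && (j != i) = (j < k)%N.
    by rewrite ltnS -(inj_eq val_inj) [RHS]ltn_neqAle andbC.
  rewrite !(eq_bigl _ _ P) mulrDr (truncS i) addrA.
  have := @MVT_le R (fun s => f (x + trunc k h + s *: delta_mx ord0 i))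
    (fun s => partial i f (x + trunc k h + s *: delta_mx ord0 i))
    (h ord0 i) (partial i f x) (e / B).
  have hb (s : R) : `|s| <= `|h ord0 i| ->
      ball x r (x + trunc k h + s *: delta_mx ord0 i).
    move=> si; split=> // a j; rewrite ord1 !mxE eqxx/= /ball/= -addrA opprD addNKr normrN.
    have [->|ji] := eqVneq j i.
      by rewrite ltnn add0r mulr1; apply: le_lt_trans (hr i).
    rewrite mulr0 addr0; case: ifP => _; last by rewrite normr0.
    by have := hr j; rewrite mxE.
  move=> /(_ (fun s si => has_partial_line ((H _ (hb s si)).1 i)))
         /(_ (fun s si => (H _ (hb s si)).2 i)).
  rewrite scale0r addr0 => M.
  apply: le_trans (lerD M (IH (ltnW kn))).
  apply: le_trans (ler_normD _ _); rewrite le_eqVlt; apply/orP; left; apply/eqP.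
  by congr (`|_|); ring.
have := Hk n (leqnn n).
have -> : trunc n h = h by apply/rowP => j; rewrite mxE ltn_ord.
rewrite (eq_bigl _ _ (fun i : 'I_n => ltn_ord i)).
rewrite [X in _ <= _ * X](eq_bigl _ _ (fun i : 'I_n => ltn_ord i)).
rewrite (eq_bigr (fun i => t * (w ord0 i * partial i f x))); last first.
  by move=> i _; rewrite mxE mulrA.
rewrite -[X in _ - _ - X]mulr_sumr.
move=> /le_trans; apply.
rewrite (eq_bigr (fun i => `|t| * `|w ord0 i|)); last by move=> i _; rewrite mxE normrM.
rewrite -mulr_sumr mulrA [_ * `|t|]mulrC -mulrA [leRHS]mulrC ler_wpM2l//.
rewrite mulrAC ler_pdivrMr//; apply: ler_wpM2l; first exact: ltW.
by rewrite /B lerDr.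
Qed.

Lemma C2_sdiff2 (R : realType) (n : nat) (D : set 'rV[R]_n) (f : 'rV[R]_n -> R)
    (x w : 'rV[R]_n) : open D -> C2_on D f -> D x ->
  sdiff2 (fun t => f (x + t *: w)) (qf (\matrix_(i, j) partial i (partial j f) x) w).
Proof.
move=> oD C2 Dx; have nD y : D y -> \forall z \near y, D z.
  by move=> Dy; apply: open_nbhs_nbhs; split.
have [d d0 Dd] := near_line w (nD _ Dx).
pose dg (t : R) := \sum_i w ord0 i * partial i f (x + t *: w).
apply: (@sdiff2_is_derive _ _ dg _ d) => // [t /Dd Dt|].
  apply: is_derive_line; apply: partials_line.
    by apply: filterS (nD _ Dt) => y /C2[_ H _] i; exact: (H i).1.
  by move=> i; have [_ H _] := C2 _ Dt; exact: (H i).2.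
have H i : is_derive (0 : R) 1 (fun t : R => partial i f (x + t *: w))
    (\sum_j w ord0 j * partial j (partial i f) x).
  apply: partials_line.
    by apply: filterS (nD _ Dx) => y /C2[_ _ K] j; exact: (K j i).1.
  by move=> j; have [_ _ K] := C2 _ Dx; exact: (K j i).2.
have := @is_derive_sum _ _ _ n
  (fun i (t : R) => w ord0 i * partial i f (x + t *: w)) (0 : R) 1
  (fun i => w ord0 i * \sum_j w ord0 j * partial j (partial i f) x)
  (fun i => is_deriveZ _ (H i)).
rewrite qfE exchange_big/=.
rewrite (_ : \sum_(i < n) _ = dg); last by rewrite /dg; apply/funext => t; rewrite fct_sumE.
congr (is_derive _ _ _ _); apply: eq_bigr => i _; rewrite mulr_sumr.
by apply: eq_bigr => j _; rewrite mxE; ring.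
Qed.

(** Cholesky factorization by induction on the dimension, valid for singular matrices: a zero pivot
    forces its whole row to vanish, a positive pivot leaves a semidefinite Schur complement. *)
Lemma psd_factor (R : realType) (n : nat) (M : 'M[R]_n) : M^T = M ->
  (forall w, 0 <= qf M w) -> exists W : 'M[R]_n, M = W^T *m W.
Proof.
elim: n M => [|n IH] M Ms Mp; first by exists 0; apply/matrixP => -[].
pose al := M ord0 ord0; pose b : 'rV[R]_n := ursubmx (M : 'M[R]_(1 + n)).
pose D : 'M[R]_n := drsubmx (M : 'M[R]_(1 + n)).
have Eu : ulsubmx (M : 'M[R]_(1 + n)) = al%:M.
  by apply/matrixP => i j; rewrite !ord1 !mxE eqxx; congr (M _ _); apply: val_inj.
have Ed : dlsubmx (M : 'M[R]_(1 + n)) = b^T by rewrite -[in LHS]Ms trmx_ursub.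
have EM : M = block_mx al%:M b b^T D by rewrite -Eu -Ed submxK.
have Ds : D^T = D by rewrite /D trmx_drsub Ms.
have Mq (c : R) (w : 'rV[R]_n) : 0 <= al * c ^+ 2 + 2 * c * dotr b w + qf D w.
  have : 0 <= (row_mx c%:M w *m block_mx al%:M b b^T D *m
      (row_mx c%:M w : 'rV[R]_(1 + n))^T) ord0 ord0 by rewrite -EM; exact: Mp.
  rewrite mul_row_block tr_row_mx mul_row_col.
  rewrite !mulmxDl tr_scalar_mx !mul_scalar_mx !mul_mx_scalar.
  have -> : w *m b^T = (dotr b w)%:M.
    by apply/matrixP => i j; rewrite !ord1 [RHS]mxE eqxx -/(dotr w b) dotrC.
  rewrite -scalemxAl -/(qf D w) 8!mxE eqxx /= [(c *: (b *m _)) _ _]mxE -/(dotr b w) -/(qf D w).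
  by congr (0 <= _); ring.
have Eb (x : 'M[R]_1) (y : 'rV[R]_n) (z : 'M[R]_n) :
    (block_mx x y 0 z)^T *m block_mx x y 0 z =
    block_mx (x^T *m x) (x^T *m y) (y^T *m x) (y^T *m y + z^T *m z).
  by rewrite tr_block_mx mulmx_block !trmx0 !mul0mx !mulmx0 !addr0.
have al0 : 0 <= al by have := Mq 1 0; rewrite /qf /dotr trmx0 !mulmx0 !mxE; lra.
have [al1|al1] := eqVneq al 0.
  have b0 : b = 0.
    apply/eqP; rewrite -nsq_eq0; apply: contraT => bn.
    have bp : 0 < nsq b by rewrite lt_def bn nsq_ge0.
    (* With zero pivot the form is affine in the first coordinate; at this value it equals
       [- 2 (1 + |qf D b|) + qf D b], which is negative. *)
    have := Mq (- (1 + `|qf D b|) / nsq b) b; rewrite al1 mul0r add0r -/(nsq b).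
    rewrite -mulrA divfK//; have := ler_norm (qf D b); have := normr_ge0 (qf D b); lra.
  have [w|W WD] := IH D Ds.
    by have := Mq 0 w; rewrite expr0n mulr0 mulr0 mul0r !add0r.
  exists (block_mx 0 0 0 W : 'M[R]_(1 + n)).
  apply: etrans EM _; apply/esym; apply: etrans (Eb _ _ _) _.
  by rewrite -WD al1 b0 !trmx0 !mulmx0 add0r raddf0.
have alp : 0 < al by rewrite lt_def al1.
pose s := Num.sqrt al; have s0 : s != 0 by rewrite gt_eqF// sqrtr_gt0.
have ss : s * s = al by rewrite -expr2 sqr_sqrtr.
have [||W WD] := IH (D - al^-1 *: (b^T *m b)).
- by rewrite linearB/= linearZ/= trmx_mul trmxK Ds.
(* This first coordinate minimizes the form for fixed [w], and the minimum is the Schur complement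
   at [w]. *)
- move=> w; have := Mq (- dotr b w / al) w.
  have bw : w *m b^T = (dotr b w)%:M.
    by apply/matrixP => i j; rewrite !ord1 [RHS]mxE eqxx -/(dotr w b) dotrC.
  have -> : qf (D - al^-1 *: (b^T *m b)) w = qf D w - al^-1 * dotr b w ^+ 2.
    rewrite /qf mulmxBr mulmxBl [LHS]mxE [X in _ + X]mxE; congr (_ - _).
    rewrite -scalemxAr -scalemxAl mulmxA bw mul_scalar_mx -scalemxAl.
    by rewrite [LHS]mxE [X in _ * X]mxE.
  by congr (0 <= _); field.
exists (block_mx s%:M (s^-1 *: b) 0 W : 'M[R]_(1 + n)).
apply: etrans EM _; apply/esym; apply: etrans (Eb _ _ _) _.
have -> : (s^-1 *: b)^T = s^-1 *: b^T by rewrite linearZ.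
rewrite tr_scalar_mx !mul_scalar_mx mul_mx_scalar -scalemxAl -scalemxAr.
by rewrite !scalerA -WD -invfM ss scale_scalar_mx ss mulfV// !scale1r addrC subrK.
Qed.

(** * Perturbations of the Laplacian and comparison *)

(* The equation for a coefficient matrix proportional to I + S^T S. *)
Definition near_laplace (R : realType) (n : nat) (eta : R)
    (u : 'rV[R]_n -> R) (x : 'rV[R]_n) : Prop :=
  exists H S : 'M[R]_n,
    [/\ forall w, sdiff2 (fun t => u (x + t *: w)) (qf H w),
        \tr H + \sum_k qf H (row k S) = 0 &
        \sum_k nsq (row k S) <= eta].

(** The matrix [S] in the equation of a solution is unknown and changes from point to point, so a
    barrier must be strict for all admissible [S] at once. The second derivatives are given as a
    bare function [p] of the direction, ready for explicit radial formulas. *)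
Definition strict_super (R : realType) (n : nat) (eta : R)
    (phi : 'rV[R]_n -> R) (x : 'rV[R]_n) : Prop :=
  exists2 p : 'rV[R]_n -> R,
    forall w, sdiff2 (fun t => phi (x + t *: w)) (p w) &
    forall S : 'M[R]_n, \sum_k nsq (row k S) <= eta ->
      \sum_(i < n) p (delta_mx ord0 i) + \sum_k p (row k S) < 0.

Lemma qfZ (R : realType) (n : nat) (c : R) (H : 'M[R]_n) (w : 'rV[R]_n) :
  qf (c *: H) w = c * qf H w.
Proof. by rewrite /qf -scalemxAr -scalemxAl mxE. Qed.

Lemma qf_delta (R : realType) (n : nat) (H : 'M[R]_n) :
  \sum_(i < n) qf H (delta_mx ord0 i) = \tr H.
Proof.
apply: eq_bigr => i _; rewrite /qf -rowE mxE (bigD1 i)//= big1 ?addr0.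
  by rewrite !mxE !eqxx mulr1.
by move=> j ji; rewrite !mxE (negbTE ji) andbF mulr0.
Qed.

(** A negative [a] is allowed, so lower bounds follow from upper comparison applied to [- u]. *)
Lemma near_laplace_affine (R : realType) (n : nat) (eta a b : R)
    (u : 'rV[R]_n -> R) (x : 'rV[R]_n) :
  near_laplace eta u x -> near_laplace eta (fun y => a * u y + b) x.
Proof.
move=> [H [S [Hu tr Sb]]]; exists (a *: H), S; split=> // [w|].
  by rewrite qfZ -[a * _]addr0; apply: sdiff2D; [exact: sdiff2Z|exact: sdiff2_cst].
rewrite mxtraceZ (eq_bigr (fun k => a * qf H (row k S))).
  by rewrite -mulr_sumr -mulrDr tr mulr0.
by move=> k _; rewrite qfZ.
Qed.

Lemma near_laplace_le (R : realType) (n : nat) (eta eta' : R)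
    (u : 'rV[R]_n -> R) (x : 'rV[R]_n) :
  eta <= eta' -> near_laplace eta u x -> near_laplace eta' u x.
Proof. by move=> ee [H [S [? ? Se]]]; exists H, S; split=> //; exact: le_trans ee. Qed.

(** At a maximum of [u - phi] over [K], boundary points fall under the first alternative. At an
    interior point each second derivative of [u] is at most that of [phi]; adding these over the
    basis and the rows of the [S] belonging to [u] gives [0 < 0]. The parameter [eta] may vary with
    the point. *)
Lemma comparison (R : realType) (n : nat) (K : set 'rV[R]_n)
    (u phi : 'rV[R]_n -> R) : compact K ->
  (forall x, K x -> {for x, continuous u}) ->
  (forall x, K x -> {for x, continuous phi}) ->
  (forall x, K x -> u x <= phi x \/ (\forall y \near x, K y) /\
     exists eta, near_laplace eta u x /\ strict_super eta phi x) ->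
  forall x, K x -> u x <= phi x.
Proof.
move=> cK cu cphi H x0 Kx0.
have [||x + xmax] := @compact_EVT_max _ R (fun x => u x - phi x) K _ cK.
- by exists x0.
- apply: continuous_in_subspaceT => x; rewrite inE => Kx.
  by apply: continuousB; [exact: cu|exact: cphi].
rewrite inE => Kx.
have {}xmax y : K y -> u y - phi y <= u x - phi x.
  by move=> Ky; apply: xmax; rewrite inE.
suff: u x <= phi x by have := xmax _ Kx0; lra.
have [//|[nK [eta [[M [S [uM tr Se]]] [p sp pS]]]]] := H _ Kx.
have lep w : qf M w <= p w.
  rewrite -subr_le0; apply: sdiff2_le0 (sdiff2B (uM w) (sp w)) _.
  have [d d0 Kd] := near_line w nK; exists d => // t /Kd/xmax.
  by rewrite scale0r addr0.
have := pS _ Se; rewrite ltNge => /negP[].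
apply: (@le_trans _ _ (\tr M + \sum_k qf M (row k S))); first by rewrite tr.
rewrite -qf_delta; apply: lerD; apply: ler_sum => i _; exact: lep.
Qed.

Lemma nsq_shift_line (R : realType) (n : nat) (x c w : 'rV[R]_n) (t : R) :
  nsq (x + t *: w - c) = nsq (x - c) + 2 * t * dotr (x - c) w + t ^+ 2 * nsq w.
Proof. by rewrite addrAC nsq_line. Qed.

Lemma sdiff2_nsq_powR (R : realType) (n : nat) (e : R) (x c w : 'rV[R]_n) :
  0 < nsq (x - c) ->
  sdiff2 (fun t => nsq (x + t *: w - c) `^ e)
     (4 * e * (e - 1) * nsq (x - c) `^ (e - 2) * dotr (x - c) w ^+ 2
      + 2 * e * nsq (x - c) `^ (e - 1) * nsq w).
Proof.
move=> s0; set s := nsq (x - c) in s0 *; set b := dotr _ w; set d := nsq w.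
pose P (t : R) := s + 2 * t * b + t ^+ 2 * d.
rewrite (_ : (fun t => _) = (@powR R ^~ e) \o P); last first.
  by apply/funext => t; rewrite nsq_shift_line.
have dP (t : R) : is_derive t 1 P (2 * b + 2 * t * d).
  rewrite /P; apply: is_derive_eq; rewrite /GRing.scale/=; ring.
have : \forall y \near x, 0 < enorm (y - c).
  by apply: near_enorm_gt; rewrite enormE sqrtr_gt0.
move=> /(near_line w)[r r0 Hr].
have Pgt0 (t : R) : `|t| < r -> 0 < P t.
  by move/Hr; rewrite enormE sqrtr_gt0 nsq_shift_line.
have P0 : P 0 = s by rewrite /P; ring.
apply: (@sdiff2_is_derive R _ (fun t => e * P t `^ (e - 1) * (2 * b + 2 * t * d)) _ r) => //.
  move=> t tr; apply: is_derive1_comp (dP t); apply: is_derive1_powR; exact: Pgt0.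
have dQ : is_derive (0 : R) 1 ((@powR R ^~ (e - 1)) \o P)
    ((e - 1) * P 0 `^ (e - 1 - 1) * (2 * b + 2 * 0 * d)).
  by apply: is_derive1_comp (dP 0); apply: is_derive1_powR; rewrite P0.
rewrite (_ : (fun t => _) = (fun t : R =>
  e * (((@powR R ^~ (e - 1)) \o P) t * (2 * b + 2 * t * d)))); last first.
  by apply/funext => t /=; ring.
apply: is_derive_eq; rewrite /GRing.scale/= P0.
rewrite (_ : e - 1 - 1 = e - 2); last by ring.
ring.
Qed.

Lemma dotr_delta (R : realType) (n : nat) (z : 'rV[R]_n) (i : 'I_n) :
  dotr z (delta_mx ord0 i) = z ord0 i.
Proof.
rewrite dotrE (bigD1 i)//= big1 ?addr0 ?mxE ?eqxx ?mulr1//.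
by move=> j ji; rewrite mxE (negbTE ji) andbF mulr0.
Qed.

Lemma nsq_delta (R : realType) (n : nat) (i : 'I_n) :
  nsq (delta_mx ord0 i : 'rV[R]_n) = 1.
Proof. by rewrite /nsq dotr_delta mxE !eqxx. Qed.

Lemma sum_dotr_delta (R : realType) (n : nat) (z : 'rV[R]_n) :
  \sum_(i < n) dotr z (delta_mx ord0 i) ^+ 2 = nsq z.
Proof. by rewrite nsqE; apply: eq_bigr => i _; rewrite dotr_delta. Qed.

Lemma sum_nsq_delta (R : realType) (n : nat) :
  \sum_(i < n) nsq (delta_mx ord0 i : 'rV[R]_n) = n%:R.
Proof.
rewrite (eq_bigr (fun=> 1)) => [|i _]; last exact: nsq_delta.
by rewrite sumr_const card_ord.
Qed.

(** The common shape of all barriers. Exponents are taken on the squared distance, so [e] stands for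
    the radial power [2 e]; the second power is needed for the critical decay rate, and elsewhere
    [c2 = 0]. *)
Definition power_sum (R : realType) (n : nat) (c : 'rV[R]_n)
    (c0 c1 e1 c2 e2 : R) (y : 'rV[R]_n) : R :=
  c0 + c1 * nsq (y - c) `^ e1 + c2 * nsq (y - c) `^ e2.

(* power_op n eta c e * s^(e-1), s = |x|^2, bounds from above the value at
   c |x|^(2e) of every operator admitted by near_laplace eta. *)
Definition power_op (R : realType) (n : nat) (eta c e : R) : R :=
  2 * c * e * (2 * e - 2 + n%:R) + eta * (`|c * e| * (4 * `|e - 1| + 2)).

Lemma power_op0 (R : realType) (n : nat) (eta : R) : power_op n eta 0 0 = 0.
Proof. by rewrite /power_op !mulr0 !mul0r normr0 mul0r mulr0 addr0. Qed.

(** With [s = |x - c|^2], the Laplacian of [s^e] is [2 e (2 e - 2 + n) s^(e-1)]. By Cauchy-Schwarz a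
    row [w] of [S] changes the value at [c s^e] by at most [|c e| (4 |e - 1| + 2) s^(e-1) |w|^2],
    and the [|w|^2] add up to at most [eta]. *)
Lemma strict_super_power_sum (R : realType) (n : nat) (eta : R)
    (c x : 'rV[R]_n) (c0 c1 e1 c2 e2 : R) : 0 < nsq (x - c) ->
  power_op n eta c1 e1 * nsq (x - c) `^ (e1 - 1) +
  power_op n eta c2 e2 * nsq (x - c) `^ (e2 - 1) < 0 ->
  strict_super eta (power_sum c c0 c1 e1 c2 e2) x.
Proof.
set s := nsq (x - c) => s0 neg.
pose q e w := 4 * e * (e - 1) * s `^ (e - 2) * dotr (x - c) w ^+ 2
      + 2 * e * s `^ (e - 1) * nsq w.
exists (fun w => 0 + c1 * q e1 w + c2 * q e2 w) => [w|S Se].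
  apply: sdiff2D; last by apply: sdiff2Z; exact: sdiff2_nsq_powR.
  by apply: sdiff2D; [exact: sdiff2_cst|apply: sdiff2Z; exact: sdiff2_nsq_powR].
have se e : s `^ (e - 2) * s = s `^ (e - 1).
  rewrite -{2}[s]powRr1 ?ltW// -powRD; first by congr powR; ring.
  by apply/implyP => _; rewrite gt_eqF.
have qd e : \sum_(i < n) q e (delta_mx ord0 i) =
    2 * e * (2 * e - 2 + n%:R) * s `^ (e - 1).
  rewrite big_split/= -!mulr_sumr sum_dotr_delta sum_nsq_delta -/s -(se e).
  ring.
have qS cc e : cc * \sum_k q e (row k S) <=
    eta * (`|cc * e| * (4 * `|e - 1| + 2)) * s `^ (e - 1).
  apply: le_trans (ler_norm _) _; rewrite mulr_sumr.
  apply: le_trans (ler_norm_sum _ _ _) _.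
  apply: (@le_trans _ _ (\sum_k nsq (row k S) *
      (`|cc * e| * (4 * `|e - 1| + 2) * s `^ (e - 1)))).
    apply: ler_sum => k _; rewrite /q.
    rewrite (_ : cc * _ = (cc * e) * (4 * (e - 1) * (s `^ (e - 2) *
      dotr (x - c) (row k S) ^+ 2) + 2 * (s `^ (e - 1) * nsq (row k S)))); last by ring.
    rewrite normrM (_ : nsq _ * _ = `|cc * e| * (4 * `|e - 1| *
       (s `^ (e - 1) * nsq (row k S)) + 2 * (s `^ (e - 1) * nsq (row k S)))); last by ring.
    have A0 : 0 <= s `^ (e - 1) * nsq (row k S) by rewrite mulr_ge0 ?powR_ge0 ?nsq_ge0.
    have B0 : 0 <= s `^ (e - 2) * dotr (x - c) (row k S) ^+ 2.
      by rewrite mulr_ge0 ?powR_ge0 ?sqr_ge0.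
    have BA : s `^ (e - 2) * dotr (x - c) (row k S) ^+ 2 <= s `^ (e - 1) * nsq (row k S).
      by rewrite -(se e) -mulrA ler_wpM2l ?powR_ge0// dotr_sqr_le.
    apply: ler_wpM2l => //; apply: le_trans (ler_normD _ _) _; apply: lerD.
      rewrite normrM (ger0_norm B0) normrM (ger0_norm (_ : 0 <= 4))//.
      by apply: ler_wpM2l => //; rewrite mulr_ge0.
    by rewrite normrM (ger0_norm A0) (ger0_norm (_ : 0 <= 2)).
  rewrite -mulr_suml mulrA; rewrite -[leRHS]mulrA.
  by rewrite mulrA; apply: ler_wpM2r; rewrite ?powR_ge0//; apply: ler_wpM2r => //;
    rewrite mulr_ge0// addr_ge0// mulr_ge0.
rewrite big_split/= big_split/= sumr_const mul0rn add0r.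
rewrite [X in _ + X]big_split/= big_split/= sumr_const mul0rn add0r.
rewrite -!mulr_sumr !qd; move: neg (qS c1 e1) (qS c2 e2).
rewrite /power_op; lra.
Qed.

Lemma power_sum_continuous (R : realType) (n : nat) (c x : 'rV[R]_n)
    (c0 c1 e1 c2 e2 : R) : 0 < nsq (x - c) ->
  {for x, continuous (power_sum c c0 c1 e1 c2 e2)}.
Proof.
move=> s0.
have cp e : nsq (y - c) `^ e @[y --> x] --> nsq (x - c) `^ e.
  apply: (@continuous_comp _ _ _ (fun y : 'rV[R]_n => nsq (y - c)) (@powR R ^~ e)).
    apply: (@continuous_comp _ _ _ (fun y : 'rV[R]_n => y - c) (@nsq R n)).
      by apply: (@cvgB _ _ _ (nbhs x)); [exact: cvg_id|exact: cvg_cst].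
    exact: nsq_continuous.
  apply: differentiable_continuous; apply/derivable1_diffP.
  by apply: derivable_powR; rewrite in_itv/= s0.
have F := nbhs_filter x.
apply: cvgD; first apply: cvgD.
- exact: cvg_cst.
- by apply: cvgM; [exact: cvg_cst|exact: cp].
- by apply: cvgM; [exact: cvg_cst|exact: cp].
Qed.

(** * Interior modulus of continuity *)

(** For [z != 0], the orthogonal reflection that sends [z] to [- z] and fixes the hyperplane
    orthogonal to [z]. *)
Definition householder (R : realType) (n : nat) (z : 'rV[R]_n) : 'M[R]_n :=
  1%:M - (2 / nsq z) *: (z^T *m z).

Lemma mul_householder (R : realType) (n : nat) (z w : 'rV[R]_n) :
  w *m householder z = w - (2 * dotr w z / nsq z) *: z.
Proof.
rewrite mulmxBr mulmx1 -scalemxAr mulmxA; congr (_ - _).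
have -> : w *m z^T = (dotr w z)%:M.
  by apply/matrixP => i j; rewrite !ord1 [RHS]mxE eqxx.
by rewrite mul_scalar_mx scalerA; congr (_ *: _); ring.
Qed.

Lemma householder_orth (R : realType) (n : nat) (z : 'rV[R]_n) : z != 0 ->
  (householder z)^T *m householder z = 1%:M.
Proof.
rewrite -nsq_eq0 => z0; apply/row_matrixP => i; rewrite row_mul row1.
have -> : (householder z)^T = householder z.
  by rewrite /householder linearB/= linearZ/= trmx_mul trmxK trmx1.
rewrite rowE !mul_householder dotrDl dotrNl dotrZl -/(nsq z).
rewrite -addrA -opprD -scalerDl [X in X *: _](_ : _ = 0) ?scale0r ?subr0//.
by field.
Qed.

Lemma sum_qf_householder (R : realType) (n : nat) (H : 'M[R]_n) (z : 'rV[R]_n) :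
  z != 0 ->
  \sum_(i < n) qf H (delta_mx ord0 i *m householder z) = \tr H.
Proof.
move=> z0; set Q := householder z.
rewrite (eq_bigr (fun i => qf (Q *m H *m Q^T) (delta_mx ord0 i))).
  by rewrite qf_delta mxtrace_mulC mulmxA householder_orth// mul1mx.
by move=> i _; rewrite /qf trmx_mul !mulmxA.
Qed.

Lemma sdiff2_nsq (R : realType) (n : nat) (x c w : 'rV[R]_n) :
  sdiff2 (fun t => nsq (x + t *: w - c)) (2 * nsq w).
Proof.
move=> e e0; exists 1 => // t t0 _.
rewrite !nsq_shift_line (_ : _ - _ - _ = 0) ?normr0 ?mulr_ge0 ?sqr_ge0 ?ltW//.
by ring.
Qed.

Lemma sqrt_enormE (R : realType) (n : nat) (x : 'rV[R]_n) :
  Num.sqrt (enorm x) = nsq x `^ (4^-1).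
Proof.
rewrite enormE -!powR12_sqrt ?powR_ge0 ?nsq_ge0//.
by rewrite -powRrM; congr powR; field.
Qed.

(* Second derivative test for the doubled variables, with the two copies
   coupled by the reflection exchanging the directions of x - z and z - x. *)
Lemma doubling_test (R : realType) (n : nat) (eta K L : R)
    (u : 'rV[R]_n -> R) (x y z : 'rV[R]_n) :
  0 <= K -> 0 <= L -> x != z ->
  near_laplace eta u x -> near_laplace eta u z ->
  (forall w w', exists2 d : R, 0 < d & forall t : R, `|t| < d ->
     u (x + t *: w) - u (z + t *: w')
       - K * nsq (x + t *: w - (z + t *: w')) `^ (4^-1)
       - L * nsq (x + t *: w - y)
     <= u x - u z - K * nsq (x - z) `^ (4^-1) - L * nsq (x - y)) ->
  K * nsq (x - z) `^ (4^-1 - 1) * (1 - eta) <= 2 * L * (n%:R + eta).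
Proof.
move=> K0 L0 xz [H [S [uH trH Se]]] [H' [S' [uH' trH' Se']]] lmax.
set s := nsq (x - z); have s0 : 0 < s by rewrite nsq_gt0 subr_eq0.
pose q w := 4 * 4^-1 * (4^-1 - 1) * s `^ (4^-1 - 2) * dotr (x - z) w ^+ 2
      + 2 * 4^-1 * s `^ (4^-1 - 1) * nsq w.
have test w w' : qf H w - qf H' w' - K * q (w - w') - L * (2 * nsq w) <= 0.
  have E (t : R) : x + t *: w - (z + t *: w') = x + t *: (w - w') - z.
    by rewrite scalerBr opprD !addrA addrAC [in RHS]addrAC -!addrA;
       congr (_ + _); rewrite addrCA.
  have := sdiff2B (sdiff2B (sdiff2B (uH w) (uH' w')) (sdiff2Z K (sdiff2_nsq_powR 4^-1 (w - w') s0)))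
    (sdiff2Z L (sdiff2_nsq x y w)).
  move/sdiff2_le0; apply; have [d d0 Hd] := lmax w w'; exists d => // t /Hd.
  by rewrite E !scale0r !addr0.
have se : s `^ (4^-1 - 2) * s = s `^ (4^-1 - 1).
  rewrite -{2}[s]powRr1 ?ltW// -powRD; first by congr powR; ring.
  by apply/implyP => _; rewrite gt_eqF.
have q_le w : q w <= 2^-1 * s `^ (4^-1 - 1) * nsq w.
  rewrite /q (_ : 2 * 4^-1 = 2^-1); last by field.
  rewrite gerDr; apply: mulr_le0_ge0; last exact: sqr_ge0.
  by apply: mulr_le0_ge0; [lra|exact: powR_ge0].
(* For [w] in the basis and [w'] its reflection, [w - w'] is parallel to [x - z], the direction in
   which [|x - z|^(1/2)] is concave. The sum of [q (w - w')] is [- s^(1/4 - 1)], and this is the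
   gain; the reflected basis still yields the trace of [H']. *)
have t1 : \tr H - \tr H' + K * s `^ (4^-1 - 1) - 2 * L * n%:R <= 0.
  have := @ler_sum R _ (index_enum 'I_n) xpredT _ _
    (fun i _ => test (delta_mx ord0 i) (delta_mx ord0 i *m householder (x - z))).
  rewrite sumr_const mul0rn; congr (_ <= 0).
  rewrite !big_split/= !sumrN qf_delta sum_qf_householder ?subr_eq0//.
  rewrite -!mulr_sumr sum_nsq_delta.
  rewrite (eq_bigr (fun i => - s `^ (4^-1 - 2) * dotr (x - z) (delta_mx ord0 i) ^+ 2)).
    by rewrite -mulr_sumr sum_dotr_delta -/s -se; ring.
  move=> i _; rewrite mul_householder opprB addrC subrK /q nsqZ dotrZr -/(nsq (x - z)).
  rewrite -/s -se (dotrC _ (x - z)); field.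
  by rewrite gt_eqF.
(* [S] and [S'] belong to different points and are unrelated, so their rows are tested with the
   other variable held fixed. Each test costs a term proportional to [eta], which [t1] absorbs. *)
have t2 : \sum_k qf H (row k S) <= (K * 2^-1 * s `^ (4^-1 - 1) + 2 * L) * eta.
  apply: (@le_trans _ _ (\sum_k (K * 2^-1 * s `^ (4^-1 - 1) + 2 * L) * nsq (row k S))).
    apply: ler_sum => k _; have := test (row k S) 0.
    rewrite subr0 {2}/qf mul0mx mul0mx mxE subr0.
    have := ler_wpM2l K0 (q_le (row k S)); lra.
  rewrite -mulr_sumr; apply: ler_wpM2l => //.
  by rewrite addr_ge0 ?mulr_ge0 ?powR_ge0.
have t3 : - \sum_k qf H' (row k S') <= (K * 2^-1 * s `^ (4^-1 - 1)) * eta.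
  apply: (@le_trans _ _ (\sum_k (K * 2^-1 * s `^ (4^-1 - 1)) * nsq (row k S'))).
    rewrite -sumrN; apply: ler_sum => k _; have := test 0 (row k S').
    rewrite sub0r {1}/qf mul0mx mul0mx mxE nsq0 sub0r.
    have := ler_wpM2l K0 (q_le (- row k S')); rewrite nsqN; lra.
  by rewrite -mulr_sumr; apply: ler_wpM2l => //; rewrite !mulr_ge0 ?powR_ge0.
lra.
Qed.

Lemma closed_ball_compact (R : realType) (n : nat) (c : 'rV[R]_n) (r : R) :
  compact [set x : 'rV[R]_n | enorm (x - c) <= r].
Proof.
rewrite (_ : mkset _ = [set x | 0 <= enorm (x - 0) /\ enorm (x - c) <= r]).
  exact: compact_annulus.
by apply/seteqP; split => x /= => [?|[]//]; split=> //; exact: enorm_ge0.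
Qed.

Lemma interior_modulus (R : realType) (n : nat) (eta T rho : R)
    (u : 'rV[R]_n -> R) (y : 'rV[R]_n) :
  eta <= 2^-1 -> 0 < rho -> 0 < T ->
  (forall x, enorm (x - y) <= rho -> [/\ 0 <= u x <= T,
     {for x, continuous u} & near_laplace eta u x]) ->
  forall z, enorm (z - y) <= rho ->
  u y - u z <= 4 * n.+1%:R * T * Num.sqrt (enorm (z - y) / rho).
Proof.
move=> eta2 rho0 T0 Hu z0 Hz0.
pose r := Num.sqrt rho; have r0 : 0 < r by rewrite sqrtr_gt0.
have rr : r ^+ 2 = rho by rewrite sqr_sqrtr// ltW.
pose N : R := 4 * n.+1%:R.
have N4 : 4 <= N by rewrite /N ler_peMr// ler1n.
have N0 : 0 < N by lra.
(* [L (rho / 2)^2 = T] keeps the [x] of a positive maximum within [rho / 2] of [y]. The value of [K]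
   forces [N |x - z|^(1/2) < r], hence [|x - z| < rho / 16], so [z] is interior too. *)
pose K := N * T / r; pose L := 4 * T / r ^+ 4.
have K0 : 0 < K by rewrite !mulr_gt0// invr_gt0.
have L0 : 0 < L by rewrite !mulr_gt0// invr_gt0 exprn_gt0.
pose F (p : 'rV[R]_n * 'rV[R]_n) := u p.1 - u p.2
  - K * Num.sqrt (enorm (p.1 - p.2)) - L * nsq (p.1 - y).
pose B := [set x : 'rV[R]_n | enorm (x - y) <= rho].
have cB : compact (B `*` B) by apply: compact_setX; exact: closed_ball_compact.
(* Putting the first variable at [y] removes the [L] term and leaves exactly the claimed modulus at
   [y]. *)
suff Fle p : (B `*` B) p -> F p <= 0.
  have yB : B y by rewrite /B/= subrr enorm0 ltW.
  have := Fle (y, z0) (conj yB Hz0).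
  rewrite /F/= subrr nsq0 mulr0 subr0 enormC sqrtrM ?enorm_ge0// (sqrtrV (ltW rho0)).
  rewrite -/r -/N /K. rewrite subr_le0 => /le_trans; apply.
  by rewrite le_eqVlt; apply/orP; left; apply/eqP; ring.
have cF : {within B `*` B, continuous F}.
  apply: continuous_in_subspaceT => -[a b]; rewrite inE => -[/= Ba Bb].
  have [_ ua _] := Hu _ Ba; have [_ ub _] := Hu _ Bb.
  have FF := nbhs_filter (a, b).
  have ca : p.1 @[p --> (a, b)] --> a by exact: cvg_fst.
  have cb : p.2 @[p --> (a, b)] --> b by exact: cvg_snd.
  apply: (@cvgB _ _ _ (nbhs (a, b))); first apply: (@cvgB _ _ _ (nbhs (a, b)));
    first apply: (@cvgB _ _ _ (nbhs (a, b))).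
  - exact: (cvg_comp _ _ ca ua).
  - exact: (cvg_comp _ _ cb ub).
  - apply: (@cvgM _ _ (nbhs (a, b))); first exact: cvg_cst.
    have cab : p.1 - p.2 @[p --> (a, b)] --> a - b by exact: (@cvgB _ _ _ (nbhs (a, b))).
    exact: (cvg_comp _ _ (cvg_comp _ _ cab (@enorm_continuous R n (a - b)))
      (@sqrt_continuous R (enorm (a - b)))).
  - apply: (@cvgM _ _ (nbhs (a, b))); first exact: cvg_cst.
    have cay : p.1 - y @[p --> (a, b)] --> a - y.
      by apply: (@cvgB _ _ _ (nbhs (a, b))) => //; exact: cvg_cst.
    exact: (cvg_comp _ _ cay (@nsq_continuous R n (a - y))).
move=> Bp.
have [x [z [Bx Bz xmax]]] : exists x z : 'rV[R]_n,
    [/\ B x, B z & forall a b, B a -> B b -> F (a, b) <= F (x, z)].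
  have [|[x z] + xmax] := compact_EVT_max _ cB cF; first by exists p.
  rewrite inE => -[/= Bx Bz]; exists x, z; split=> // a b Ba Bb.
  by apply: xmax; rewrite inE.
suff F0 : F (x, z) <= 0.
  by case: p Bp => a b [Ba Bb]; apply: le_trans F0; exact: xmax.
rewrite leNgt; apply/negP => Fgt0.
have [/andP[ux0 uxT] _ plx] := Hu _ Bx; have [/andP[uz0 uzT] _ plz] := Hu _ Bz.
pose P : R := Num.sqrt (enorm (x - z)).
have P0 : 0 <= P by exact: sqrtr_ge0.
have Pn : P ^+ 2 = enorm (x - z) by rewrite sqr_sqrtr// enorm_ge0.
have nL : 0 <= L * nsq (x - y) by rewrite mulr_ge0 ?nsq_ge0// ltW.
have KP : 0 <= K * P by rewrite mulr_ge0// ltW.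
have FE : F (x, z) = u x - u z - K * P - L * nsq (x - y) by [].
have Fp : 0 < u x - u z - K * P - L * nsq (x - y) by rewrite -FE.
have KPT : K * P < T by lra.
have PN : N * P < r by move: KPT; rewrite /K mulrAC ltr_pdivrMr// mulrAC mulrC ltr_pM2l.
have xz : x != z.
  apply: contraTneq Fgt0 => xz; rewrite -leNgt FE; have -> : u x = u z by rewrite xz.
  lra.
have Pgt0 : 0 < P by rewrite sqrtr_gt0 enorm_gt0 subr_eq0.
have xh : enorm (x - y) < rho / 2.
  rewrite ltNge; apply/negP => h.
  have : T <= L * nsq (x - y); last by lra.
  have : (rho / 2) ^+ 2 <= nsq (x - y).
    by rewrite -enorm_sqr ler_pXn2r// nnegrE ?enorm_ge0// divr_ge0// ltW.
  move/(ler_wpM2l (ltW L0)); apply: le_trans.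
  rewrite -rr /L le_eqVlt; apply/orP; left; apply/eqP; field.
  by rewrite gt_eqF.
have zh : enorm (z - y) < rho.
  apply: le_lt_trans (enorm_triangle z x y) _.
  rewrite (enormC z x) -Pn -rr; rewrite -rr in xh.
  have : P ^+ 2 < (r / 4) ^+ 2; last by move: xh; lra.
  rewrite ltr_pXn2r ?nnegrE ?divr_ge0 ?ltW// ltr_pdivlMr//.
  by apply: le_lt_trans PN; rewrite mulrC ler_wpM2r.
have := @doubling_test R n eta K L u x y z (ltW K0) (ltW L0) xz plx plz.
rewrite (_ : nsq (x - z) `^ (4^-1 - 1) = P ^- 3); last first.
  have s0 : nsq (x - z) != 0 by rewrite nsq_eq0 subr_eq0.
  rewrite powRB; last by apply/implyP.
  rewrite (powRr1 (nsq_ge0 _)) -sqrt_enormE -/P -enorm_sqr -Pn; field.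
  by rewrite gt_eqF.
have interior a w : enorm (a - y) < rho ->
    exists2 d : R, 0 < d & forall t : R, `|t| < d -> B (a + t *: w).
  by move=> /near_enorm_lt/(near_line w)[d d0 Hd]; exists d => // t /Hd/ltW.
move=> dtest; suff: ~~ (K * P ^- 3 * (1 - eta) <= 2 * L * (n%:R + eta)).
- move=> /negP; apply; apply: dtest => w w'.
  have [|d1 d10 Hx] := interior x w; first by lra.
  have [d2 d20 Hz] := interior z w' zh.
  exists (Num.min d1 d2); first by rewrite lt_min d10.
  move=> t; rewrite lt_min => /andP[/Hx Bxt /Hz Bzt].
  by have := xmax _ _ Bxt Bzt; rewrite /F/= !sqrt_enormE.
- rewrite -ltNge.
  have n1 : N = 4 * (n%:R + 1) by rewrite /N natr1.
  have n0 : (0 : R) <= n%:R by exact: ler0n.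
  (* Since [eta <= 1/2], the left side of the doubling inequality is at least [K P^-3 / 2], while
     the right side is at most [2 N T / r^4]. A contradiction thus requires only [4 P^3 < r^3],
     which follows from [N P < r] and [N >= 4]. *)
  have PN3 : N ^+ 3 * P ^+ 3 < r ^+ 3.
    by rewrite -exprMn ltr_pXn2r// nnegrE ?mulr_ge0// ltW.
  have P3 : 0 < P ^+ 3 by rewrite exprn_gt0.
  apply: (@le_lt_trans _ _ (8 * T / r ^+ 4 * (n%:R + 1))).
    rewrite /L (_ : 2 * _ = 8 * T / r ^+ 4); last by ring.
    apply: ler_wpM2l; last by lra.
    by apply: ltW; rewrite !mulr_gt0// invr_gt0 exprn_gt0.
  apply: (@lt_le_trans _ _ (K * P ^- 3 * 2^-1)); last first.
    by apply: ler_wpM2l; [apply: ltW; rewrite mulr_gt0// invr_gt0|lra].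
  rewrite -subr_gt0 (_ : _ - _ = T / r ^+ 4 / P ^+ 3 / 2 *
     (N * r ^+ 3 - 4 * N * P ^+ 3)); last first.
    by rewrite /K n1; field; rewrite !gt_eqF.
  apply: mulr_gt0; first by rewrite !mulr_gt0// invr_gt0 ?exprn_gt0.
  rewrite (_ : _ - _ = N * (r ^+ 3 - 4 * P ^+ 3)); last by ring.
  rewrite mulr_gt0// subr_gt0; apply: le_lt_trans PN3.
  apply: ler_wpM2r; first exact: ltW.
  by apply: (le_trans N4); rewrite ler_eXnr//; lra.
Qed.

(** * Harnack inequality *)

Lemma nsq_powR (R : realType) (n : nat) (x : 'rV[R]_n) (e : R) :
  nsq x `^ e = enorm x `^ (2 * e).
Proof. by rewrite powRrM -enorm_sqr powR_mulrn ?enorm_ge0. Qed.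

(** In dimension [n = k + 2] the exponent n-1 is one above the harmonic one, so [|x|^(1-n)] has
    Laplacian [(n-1) |x|^(-n-1)], strictly positive. The perturbation costs at most
    [eta (n-1) (n+2)] times the same power, whence the condition on [eta]. *)
Lemma lower_barrier (R : realType) (k : nat) (eta m r rho : R)
    (u : 'rV[R]_k.+2 -> R) (y : 'rV[R]_k.+2) :
  eta * k.+4%:R < 1 -> 0 < m -> 0 < r -> r < rho ->
  (forall x, r <= enorm (x - y) -> enorm (x - y) <= rho ->
     {for x, continuous u} /\ near_laplace eta u x) ->
  (forall x, enorm (x - y) = r -> m <= u x) ->
  (forall x, enorm (x - y) = rho -> 0 <= u x) ->
  forall x, r <= enorm (x - y) -> enorm (x - y) <= rho ->
    m * r ^+ k.+1 * (enorm (x - y) ^- k.+1 - rho ^- k.+1) <= u x.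
Proof.
move=> eta1 m0 r0 rrho Hu ur urho.
have rho0 : 0 < rho by apply: lt_trans rrho.
pose e : R := - (k.+1%:R / 2).
pose c0 := m * r ^+ k.+1 * rho ^- k.+1; pose c1 := - (m * r ^+ k.+1).
have phiE x : power_sum y c0 c1 e 0 0 x = c0 + c1 * enorm (x - y) ^- k.+1.
  rewrite /power_sum mul0r addr0 nsq_powR (_ : 2 * e = - k.+1%:R).
    by rewrite powR_invn ?enorm_ge0.
  by rewrite /e mulrN mulrCA divff ?mulr1.
suff H x : [set x | r <= enorm (x - y) /\ enorm (x - y) <= rho] x ->
    -1 * u x + 0 <= power_sum y c0 c1 e 0 0 x.
  move=> x xr xrho; have := H x (conj xr xrho).
  by rewrite phiE /c0 /c1; lra.
apply: (@comparison R k.+2 _ (fun x => -1 * u x + 0) (power_sum y c0 c1 e 0 0)).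
- exact: compact_annulus.
- move=> {}x [/= xr xrho]; apply: (@cvgD _ _ _ (nbhs x)); last exact: cvg_cst.
  by apply: (@cvgM _ _ (nbhs x)); [exact: cvg_cst|exact: (Hu _ xr xrho).1].
- move=> {}x [/= xr xrho]; apply: power_sum_continuous.
  by rewrite -enorm_sqr exprn_gt0// (lt_le_trans r0).
move=> {}x [/= xr xrho].
have [xr1|xr1] := eqVneq (enorm (x - y)) r.
  left; rewrite phiE xr1 mulN1r /c1 mulNr mulfK ?expf_neq0 ?gt_eqF//.
  have := ur _ xr1; have : 0 < c0; last by lra.
  by rewrite !mulr_gt0 ?invr_gt0 ?exprn_gt0.
have [xr2|xr2] := eqVneq (enorm (x - y)) rho.
  by left; rewrite phiE xr2 mulN1r /c0 /c1 mulNr subrr; have := urho _ xr2; lra.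
right; split.
  have /near_enorm_gt A : r < enorm (x - y) by rewrite lt_def xr1.
  have /near_enorm_lt B : enorm (x - y) < rho by rewrite lt_def eq_sym xr2.
  by apply: filterS2 A B => z /ltW ? /ltW.
exists eta; split; first by apply: near_laplace_affine; exact: (Hu _ xr xrho).2.
have s0 : 0 < nsq (x - y) by rewrite -enorm_sqr exprn_gt0// (lt_le_trans r0).
apply: strict_super_power_sum => //.
rewrite power_op0 mul0r addr0.
rewrite pmulr_llt0 ?powR_gt0//.
have k0 : 0 < k.+1%:R :> R by rewrite ltr0n.
have mr : 0 < m * r ^+ k.+1 by rewrite mulr_gt0 ?exprn_gt0.
rewrite /power_op ger0_norm; last first.
  by rewrite /c1 /e mulrNN; apply: ltW; rewrite mulr_gt0// divr_gt0.
rewrite ler0_norm; last by rewrite /e; lra.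
have E1 : k.+4%:R = k.+1%:R + 3 :> R by rewrite -natrD addn3.
have E2 : k.+2%:R = k.+1%:R + 1 :> R by rewrite natr1.
rewrite E1 in eta1; rewrite E2 /c1 /e; move: eta1 k0; set K := k.+1%:R => eta1 k0.
rewrite (_ : _ + _ = m * r ^+ k.+1 * K * (eta * (K + 3) - 1)); last by field.
by rewrite pmulr_rlt0 ?subr_lt0// mulr_gt0.
Qed.

Lemma harnack_ball (R : realType) (k : nat) : exists2 kappa : R, 0 < kappa &
  forall (eta rho : R) (u : 'rV[R]_k.+2 -> R) (c : 'rV[R]_k.+2),
  eta <= 2^-1 -> eta * k.+4%:R < 1 -> 0 < rho ->
  (forall x, enorm (x - c) <= 4 * rho ->
     [/\ 0 <= u x, {for x, continuous u} & near_laplace eta u x]) ->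
  forall x1 x2, enorm (x1 - c) <= rho / 2 -> enorm (x2 - c) <= rho / 2 ->
  kappa * u x1 <= u x2.
Proof.
(* Chosen so that the interior modulus with bound [2^(n-1) u(y)], at relative distance [sg^2], is
   exactly [u(y) / 2]. *)
pose sg : R := (8 * k.+3%:R * 2 ^+ k.+1)^-1.
have sg0 : 0 < sg by rewrite invr_gt0 !mulr_gt0 ?exprn_gt0 ?ltr0n.
have sg1 : sg <= 1.
  rewrite invf_le1 ?mulr_gt0 ?exprn_gt0 ?ltr0n//.
  rewrite -[leLHS]mulr1 ler_pM// ?exprn_ege1 ?ler1n//.
  by rewrite -[leLHS]mulr1 ler_pM// ?ler1n//; lra.
(* The barrier is centred at [y] with outer radius [3 rho], which stays in the ball of radius
   [4 rho] about [c], and it is evaluated within distance [2 rho] of [y]. *)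
pose q : R := 2 ^- k.+1 - 3 ^- k.+1.
have q0 : 0 < q by rewrite subr_gt0 ltf_pV2 ?posrE ?exprn_gt0// ltr_pXn2r ?nnegrE//; lra.
have q1 : q <= 1.
  have : 2 ^- k.+1 <= 1 :> R by rewrite invf_le1 ?exprn_gt0// exprn_ege1//; lra.
  have : 0 < 3 ^- k.+1 :> R by rewrite invr_gt0 exprn_gt0.
  by rewrite /q; lra.
exists (2^-1 * (sg ^+ 2 / 2) ^+ k.+1 * q * 2 ^- k.+1).
  by rewrite !mulr_gt0 ?invr_gt0 ?exprn_gt0 ?divr_gt0 ?exprn_gt0.
move=> eta rho u c eta2 eta1 rho0 Hu x1 x2 Hx1 Hx2.
set kappa := (X in X * u x1).
pose B := [set x : 'rV[R]_k.+2 | enorm (x - c) <= rho].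
pose G x := (rho - enorm (x - c)) ^+ k.+1 * u x.
have B4 x : enorm (x - c) <= rho -> enorm (x - c) <= 4 * rho by lra.
have [|||y] := @compact_EVT_max _ R G B.
- by exists c; rewrite /B/= subrr enorm0 ltW.
- exact: closed_ball_compact.
- apply: continuous_in_subspaceT => x; rewrite inE => Bx.
  have [_ ux _] := Hu _ (B4 _ Bx).
  apply: (@cvgM _ _ (nbhs x)) => //.
  have cx : rho - enorm (z - c) @[z --> x] --> rho - enorm (x - c).
    by apply: (@cvgB _ _ _ (nbhs x)); [exact: cvg_cst|exact: enormB_continuous].
  exact: (cvg_comp _ _ cx (@exprn_continuous R k.+1 (rho - enorm (x - c)))).
rewrite inE => By Gmax.
have {}Gmax x : B x -> G x <= G y by move=> Bx; apply: Gmax; rewrite inE.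
have x1B : B x1 by rewrite /B/=; lra.
have [u1 _ _] := Hu _ (B4 _ x1B).
have [u2 _ _] : [/\ 0 <= u x2, {for x2, continuous u} & near_laplace eta u x2].
  by apply: Hu; lra.
have kap0 : 0 < kappa.
  by rewrite !mulr_gt0 ?invr_gt0 ?exprn_gt0 ?divr_gt0 ?exprn_gt0.
have [u10|u10] := eqVneq (u x1) 0; first by rewrite u10 mulr0.
have {}u10 : 0 < u x1 by rewrite lt_def u10.
pose d := rho - enorm (y - c).
have rk : 0 < (rho / 2) ^+ k.+1 by rewrite exprn_gt0// divr_gt0.
have Gy : (rho / 2) ^+ k.+1 * u x1 <= d ^+ k.+1 * u y.
  apply: le_trans (Gmax _ x1B); apply: ler_wpM2r => //.
  by rewrite ler_pXn2r ?nnegrE//; lra.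
have d0 : 0 < d.
  rewrite lt_def subr_ge0 (By : enorm (y - c) <= rho) andbT.
  by apply: contraTneq Gy => ->; rewrite expr0n mul0r -ltNge mulr_gt0.
have uy0 : 0 < u y.
  rewrite -(pmulr_rgt0 _ (_ : 0 < d ^+ k.+1)) ?exprn_gt0//.
  by apply: lt_le_trans Gy; rewrite mulr_gt0.
have drho : d <= rho by rewrite gerBl enorm_ge0.
(* On the ball of radius [d / 2] about [y] the weight base [rho - |x - c|] is at least half of its
   value [d] at [y], so maximality of [G] at [y] bounds [u] by [T] there. *)
pose T := 2 ^+ k.+1 * u y.
have T0 : 0 < T by rewrite mulr_gt0 ?exprn_gt0.
have yd x : enorm (x - y) <= d / 2 -> d / 2 <= rho - enorm (x - c).
  by have := enorm_triangle x y c; rewrite /d; lra.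
have near_y z : enorm (z - y) <= sg ^+ 2 * (d / 2) -> u y / 2 <= u z.
  move=> zs.
  have zd : enorm (z - y) <= d / 2.
    apply: le_trans zs _; rewrite ger_pMl ?divr_gt0// expr_le1//; exact: ltW.
  have := @interior_modulus R k.+2 eta T (d / 2) u y eta2 _ T0.
  move=> /(_ (divr_gt0 d0 (ltr0n R 2)))/(_ _)/(_ z zd) => H.
  have : u y - u z <= 4 * k.+3%:R * T * Num.sqrt (enorm (z - y) / (d / 2)).
    apply: H => x xd; have xd' := yd _ xd.
    have [] := Hu x; first by lra.
    move=> ux cx nx; split => //; rewrite ux/=.
    rewrite -(ler_pM2l (_ : 0 < (d / 2) ^+ k.+1)) ?exprn_gt0 ?divr_gt0//.
    rewrite /T mulrA -exprMn divfK//; apply: le_trans (Gmax x _); last by rewrite /B/=; lra.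
    by apply: ler_wpM2r => //; rewrite ler_pXn2r ?nnegrE//; lra.
  have : Num.sqrt (enorm (z - y) / (d / 2)) <= sg.
    rewrite -(ger0_norm (ltW sg0)) -sqrtr_sqr; apply: ler_wsqrtr.
    by rewrite ler_pdivrMr// divr_gt0.
  have C0 : 0 <= 4 * k.+3%:R * T by rewrite !mulr_ge0// ltW.
  move/(ler_wpM2l C0) => H1 H2.
  have := le_trans H2 H1; rewrite (_ : 4 * _ * T * sg = u y / 2); last first.
    rewrite /T /sg; field.
    by rewrite expf_neq0 ?pnatr_eq0//= -(natrD R 3) pnatr_eq0.
  by lra.
pose r := sg ^+ 2 * (d / 2).
have r0 : 0 < r by rewrite !mulr_gt0 ?exprn_gt0// divr_gt0.
have rd : r <= d / 2 by rewrite ger_pMl ?divr_gt0// expr_le1//; exact: ltW.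
have yx2 : enorm (x2 - y) <= 2 * rho.
  by have := enorm_triangle x2 c y; rewrite (enormC c y); rewrite /B/= in By; lra.
(* The barrier bound contains [r^(n-1) u(y)] with [r] proportional to [d], that is, a multiple of
   [d^(n-1) u(y) = G y]. Maximality of [G] then replaces it by the value at [x1], whatever [d]
   is. *)
have kdx : kappa * u x1 = 2^-1 * (sg ^+ 2 / 2) ^+ k.+1 * q * rho ^- k.+1 *
    ((rho / 2) ^+ k.+1 * u x1).
  by rewrite /kappa (expr_div_n rho); field; rewrite !expf_neq0// gt_eqF.
have dk : 0 < d ^+ k.+1 by rewrite exprn_gt0.
have rhok : 0 < rho ^- k.+1 by rewrite invr_gt0 exprn_gt0.
have sk : 0 < (sg ^+ 2 / 2) ^+ k.+1 by rewrite exprn_gt0// divr_gt0// exprn_gt0.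
apply: (@le_trans _ _ (2^-1 * (sg ^+ 2 / 2) ^+ k.+1 * q * rho ^- k.+1 *
   (d ^+ k.+1 * u y))).
  by rewrite kdx; apply: ler_wpM2l => //; apply: ltW; rewrite !mulr_gt0// invr_gt0.
have [x2r|x2r] := leP (enorm (x2 - y)) r.
  apply: le_trans (near_y _ x2r).
  rewrite [leLHS](_ : _ = u y / 2 * ((sg ^+ 2 / 2) ^+ k.+1 * (q * (d ^+ k.+1 * rho ^- k.+1)))); last by ring.
  apply: ler_piMr; first by rewrite ltW// divr_gt0.
  have A1 : d ^+ k.+1 * rho ^- k.+1 <= 1.
    by rewrite ler_pdivrMr ?exprn_gt0// mul1r ler_pXn2r// nnegrE ltW.
  have A2 : (sg ^+ 2 / 2) ^+ k.+1 <= 1.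
    apply: exprn_ile1; first by rewrite ltW// divr_gt0// exprn_gt0.
    have : sg ^+ 2 <= 1 by rewrite expr_le1// ltW.
    by lra.
  have A10 : 0 <= d ^+ k.+1 * rho ^- k.+1 by rewrite ltW// mulr_gt0.
  have q0' := ltW q0; have sk' := ltW sk.
  by apply: mulr_ile1 => //; [exact: mulr_ge0|exact: mulr_ile1].
have := @lower_barrier R k eta (u y / 2) r (3 * rho) u y eta1 (divr_gt0 uy0 (ltr0n R 2)) r0.
have r3 : r < 3 * rho by lra.
move=> /(_ r3) LB.
have in4 x : enorm (x - y) <= 3 * rho -> enorm (x - c) <= 4 * rho.
  by have := enorm_triangle x y c; rewrite /B/= in By; lra.
have x23 : enorm (x2 - y) <= 3 * rho by lra.
have {}LB := LB _ _ _ x2 (ltW x2r) x23.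
apply: le_trans (LB _ _ _).
- rewrite [leLHS](_ : _ = u y / 2 * r ^+ k.+1 * ((2 * rho) ^- k.+1 - (3 * rho) ^- k.+1)).
    apply: ler_wpM2l; first by rewrite ltW// mulr_gt0 ?exprn_gt0 ?divr_gt0.
    rewrite lerD2r lef_pV2 ?posrE ?exprn_gt0 ?mulr_gt0//; last by apply: lt_trans x2r.
    rewrite ler_pXn2r// nnegrE ?mulr_ge0// ?enorm_ge0// ltW//.
  rewrite /r /q !exprMn !exprVn; field.
  by rewrite !expf_neq0 ?pnatr_eq0 ?(gt_eqF rho0)// -invr_eq0 gt_eqF.
- by move=> x xr xrho; have [] := Hu _ (in4 _ xrho).
- by move=> x xr; apply: near_y; rewrite xr.
- by move=> x xr; have [] := Hu x; first by apply: in4; rewrite xr.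
Qed.

Definition solves_outside (R : realType) (n : nat) (eta r : R)
    (u : 'rV[R]_n -> R) : Prop :=
  forall x, r <= enorm x -> {for x, continuous u} /\ near_laplace eta u x.

Lemma harnack_quarter (R : realType) (k : nat) : exists2 kappa : R, 0 < kappa &
  forall (eta r : R) (u : 'rV[R]_k.+2 -> R),
  eta <= 2^-1 -> eta * k.+4%:R < 1 -> 0 < r ->
  solves_outside eta (r / 4) u -> (forall x, r / 4 <= enorm x -> 0 <= u x) ->
  forall x z, enorm x = r -> enorm z = r -> 0 <= dotr x z ->
  kappa * u x <= u z.
Proof.
have [kap k0 Hk] := harnack_ball R k.
exists (kap ^+ 64); first by rewrite exprn_gt0.
move=> eta r u eta2 eta1 r0 sol upos x z xr zr xz.
(* Harnack chain along the chord. As [dotr x z >= 0], the chord stays at distance at least [r / 2]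
   from the origin, so balls of radius [4 (r / 16)] about it avoid [|x| < r / 4]. Each step has
   length at most [2 r / 64], half of [r / 16]. *)
pose p (i : nat) := x + (i%:R / 64) *: (z - x).
have p64 : p 64%N = z by rewrite /p divff// scale1r addrC subrK.
have pnorm i : (i <= 64)%N -> r / 2 <= enorm (p i).
  move=> i64; have r20 : 0 <= r / 2 by rewrite divr_ge0// ltW.
  rewrite -(@ler_pXn2r _ 2) ?nnegrE ?enorm_ge0//.
  have t0 : 0 <= i%:R / 64 :> R by rewrite divr_ge0.
  have t1 : i%:R / 64 <= 1 :> R by rewrite ler_pdivrMr// mul1r ler_nat.
  rewrite enorm_sqr /p nsq_line; move: t0 t1; set t := (_ / 64) => t0 t1.
  have -> : nsq (z - x) = nsq z + nsq x - 2 * dotr x z.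
    by rewrite /nsq !dotr_simp (dotrC z x); ring.
  rewrite dotrDr dotrNr -/(nsq x) -!enorm_sqr xr zr.
  rewrite -subr_ge0 (_ : _ - _ = r ^+ 2 * (2 * (t - 2^-1) ^+ 2 + 4^-1) +
    2 * (t * (1 - t)) * dotr x z); last by field.
  apply: addr_ge0; first by rewrite mulr_ge0 ?sqr_ge0// addr_ge0// mulr_ge0 ?sqr_ge0.
  by rewrite mulr_ge0// mulr_ge0// mulr_ge0// subr_ge0.
have chain i : (i <= 64)%N -> kap ^+ i * u x <= u (p i).
  elim: i => [_|i IH i64]; first by rewrite expr0 mul1r /p mul0r scale0r addr0.
  rewrite exprS -mulrA; apply: (le_trans (ler_wpM2l (ltW k0) (IH (ltnW i64)))).
  apply: (Hk eta (r / 16) u (p i)) => //; first by rewrite divr_gt0.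
  - move=> y yp; have ry : r / 4 <= enorm y.
      have := enormD y (p i - y); rewrite addrC subrK enormC.
      by have := pnorm _ (ltnW i64); lra.
    by have [] := sol _ ry; split=> //; exact: upos.
  - by rewrite subrr enorm0 !divr_ge0// ltW.
  have -> : p i.+1 - p i = 64^-1 *: (z - x).
    by rewrite /p opprD addrACA subrr add0r -scalerBl -natr1; congr (_ *: _); field.
  rewrite enormZ ger0_norm ?invr_ge0//.
  by have := enormD z (- x); rewrite enormN xr zr; lra.
by have := chain 64%N (leqnn _); rewrite p64.
Qed.

Lemma ex_orthogonal (R : realType) (k : nat) (x z : 'rV[R]_k.+2) (r : R) :
  0 <= r -> exists w : 'rV[R]_k.+2, [/\ enorm w = r, dotr x w = 0 & 0 <= dotr w z].
Proof.
move=> r0.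
have [w0 wn0 xw0] : exists2 w : 'rV[R]_k.+2, w != 0 & dotr x w = 0.
  have [x0|x0] := eqVneq (x ord0 ord0) 0.
    exists (delta_mx ord0 ord0); last by rewrite dotr_delta.
    by rewrite -nsq_eq0 nsq_delta oner_eq0.
  pose j : 'I_k.+2 := inord 1.
  have j0 : (j == ord0) = false.
    by apply/eqP => /(congr1 val); rewrite /= inordK.
  exists (x ord0 ord0 *: delta_mx ord0 j - x ord0 j *: delta_mx ord0 ord0).
    apply: contra_neq x0 => /rowP/(_ j); rewrite !mxE eqxx j0/=.
    by rewrite mulr1 mulr0 subr0.
  by rewrite dotrDr dotrNr !dotrZr !dotr_delta; ring.
have e0 : 0 < enorm w0 by rewrite enorm_gt0.
pose s : R := if 0 <= dotr w0 z then 1 else -1.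
exists ((s * (r / enorm w0)) *: w0); split.
- rewrite enormZ normrM (ger0_norm (_ : 0 <= r / enorm w0)) ?divr_ge0 ?enorm_ge0//.
  rewrite (_ : `|s| = 1) ?mul1r ?divfK ?gt_eqF//.
  by rewrite /s; case: ifP; rewrite ?normrN normr1.
- by rewrite dotrZr xw0 mulr0.
rewrite dotrZl mulrAC mulr_ge0 ?divr_ge0 ?enorm_ge0// /s.
case: ifPn; rewrite ?mul1r// -ltNge => /ltW.
by rewrite mulN1r oppr_ge0.
Qed.

(** The chord between nearly opposite points comes too close to the origin; an intermediate point
    orthogonal to [x], with sign chosen towards [z], replaces it by two admissible chords. *)
Lemma harnack_sphere (R : realType) (k : nat) : exists2 kappa : R, 0 < kappa &
  forall (eta r : R) (u : 'rV[R]_k.+2 -> R),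
  eta <= 2^-1 -> eta * k.+4%:R < 1 -> 0 < r ->
  solves_outside eta (r / 4) u -> (forall x, r / 4 <= enorm x -> 0 <= u x) ->
  forall x z, enorm x = r -> enorm z = r -> kappa * u x <= u z.
Proof.
have [kap k0 Hk] := harnack_quarter R k.
exists (kap ^+ 2); first by rewrite exprn_gt0.
move=> eta r u eta2 eta1 r0 sol upos x z xr zr.
have [w [wr xw wz]] := ex_orthogonal x z (ltW r0).
have H1 := Hk eta r u eta2 eta1 r0 sol upos x w xr wr.
rewrite xw in H1; have H2 := Hk eta r u eta2 eta1 r0 sol upos w z wr zr wz.
by apply: le_trans H2; rewrite expr2 -mulrA; apply: ler_wpM2l (H1 _); rewrite // ltW.
Qed.

(** * Exterior domains *)

Lemma enorm_surj (R : realType) (n : nat) (r : R) : 0 <= r ->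
  exists x : 'rV[R]_n.+1, enorm x = r.
Proof.
move=> r0; exists (r *: delta_mx ord0 ord0).
by rewrite enormZ ger0_norm// enormE nsq_delta sqrtr1 mulr1.
Qed.

Lemma affine_continuous (R : realType) (n : nat) (a b : R) (u : 'rV[R]_n -> R)
    (x : 'rV[R]_n) : {for x, continuous u} ->
  {for x, continuous (fun y => a * u y + b)}.
Proof.
move=> ux; apply: (@cvgD _ _ _ (nbhs x)); last exact: cvg_cst.
by apply: (@cvgM _ _ (nbhs x)) => //; exact: cvg_cst.
Qed.

Lemma solves_outside_affine (R : realType) (n : nat) (a b eta r : R)
    (u : 'rV[R]_n -> R) : solves_outside eta r u ->
  solves_outside eta r (fun y => a * u y + b).
Proof.
move=> sol x /sol[ux nx]; split; first exact: affine_continuous.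
exact: near_laplace_affine.
Qed.

Lemma solves_outside_le (R : realType) (n : nat) (eta r r' : R)
    (u : 'rV[R]_n -> R) : r <= r' -> solves_outside eta r u ->
  solves_outside eta r' u.
Proof. by move=> rr sol x rx; apply: sol; exact: le_trans rx. Qed.

Lemma comparison_annulus (R : realType) (n : nat) (r1 r2 : R)
    (w phi : 'rV[R]_n -> R) :
  (forall x, r1 <= enorm x -> enorm x <= r2 ->
     {for x, continuous w} /\ {for x, continuous phi}) ->
  (forall x, r1 < enorm x -> enorm x < r2 ->
     exists eta, near_laplace eta w x /\ strict_super eta phi x) ->
  (forall x, enorm x = r1 -> w x <= phi x) ->
  (forall x, enorm x = r2 -> w x <= phi x) ->
  forall x, r1 <= enorm x -> enorm x <= r2 -> w x <= phi x.
Proof.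
move=> wc wn w1 w2 x0 x01 x02.
apply: (@comparison R n [set x | r1 <= enorm (x - 0) /\ enorm (x - 0) <= r2]).
- exact: compact_annulus.
- by move=> x /=; rewrite subr0 => -[/wc H /H[]].
- by move=> x /=; rewrite subr0 => -[/wc H /H[]].
- move=> x /=; rewrite subr0 => -[xr1 xr2].
  have [xr3|xr3] := eqVneq (enorm x) r1; first by left; exact: w1.
  have [xr4|xr4] := eqVneq (enorm x) r2; first by left; exact: w2.
  have A : r1 < enorm x by rewrite lt_def xr3.
  have B : enorm x < r2 by rewrite lt_def eq_sym xr4.
  right; split; last exact: wn.
  have /near_enorm_gt A' : r1 < enorm (x - 0) by rewrite subr0.
  have /near_enorm_lt B' : enorm (x - 0) < r2 by rewrite subr0.
  by apply: filterS2 A' B' => z /ltW ? /ltW.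
- by rewrite /= subr0.
Qed.

Lemma strict_super_addr (R : realType) (n : nat) (eta b : R)
    (phi : 'rV[R]_n -> R) (x : 'rV[R]_n) : strict_super eta phi x ->
  strict_super eta (fun y => phi y + b) x.
Proof.
move=> [p sp pS]; exists p => // w; rewrite -[p w]addr0.
by apply: sdiff2D => //; exact: sdiff2_cst.
Qed.

(** The barrier is raised by [e] so that it dominates [w] on a far sphere; strictness survives the
    added constant, and [e] is arbitrary. *)
Lemma comparison_outside (R : realType) (n : nat) (r : R)
    (w phi : 'rV[R]_n -> R) :
  (forall x, r <= enorm x ->
     [/\ {for x, continuous w}, {for x, continuous phi} & 0 <= phi x]) ->
  (forall x, r <= enorm x ->
     exists eta, near_laplace eta w x /\ strict_super eta phi x) ->
  (forall x, enorm x = r -> w x <= phi x) ->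
  (forall e, 0 < e -> exists M, forall x, M <= enorm x -> w x <= e) ->
  forall x, r <= enorm x -> w x <= phi x.
Proof.
move=> wc wn wr winf x rx; apply/ler_addgt0Pr => e e0.
have [M wM] := winf _ e0.
pose r2 := Num.max M (enorm x + 1).
apply: (@comparison_annulus R n r r2 w (fun y => phi y + e)) => //.
- move=> y /wc[wy py _] _; split => //.
  by apply: (@cvgD _ _ _ (nbhs y)) => //; exact: cvg_cst.
- move=> y /ltW/wn[eta [ny sy]] _; exists eta; split=> //.
  exact: strict_super_addr.
- by move=> y /wr; lra.
- move=> y yr2; have [|_ _ ?] := wc y.
    by rewrite yr2 le_max; apply/orP; right; lra.
  by have := wM y; rewrite yr2 le_max lexx => /(_ isT); lra.
- by rewrite le_max; apply/orP; right; lra.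
Qed.

(** Here the dimension being at least 3 enters: [|x|^(-1/2)] decays and is strictly superharmonic,
    since [1/2 < n - 2]. The factor 7 is [4 |e - 1| + 2] at [e = -1/4]. *)
Lemma strict_super_quarter (R : realType) (k : nat) (eta c0 c1 : R)
    (x : 'rV[R]_k.+3) : eta * 7 < 1 -> 0 < c1 -> 0 < enorm x ->
  strict_super eta (power_sum 0 c0 c1 (- 4^-1) 0 0) x.
Proof.
move=> eta7 c10 x0; apply: strict_super_power_sum.
  by rewrite subr0 -enorm_sqr exprn_gt0.
rewrite power_op0 mul0r addr0.
rewrite pmulr_llt0 ?powR_gt0//; last by rewrite subr0 -enorm_sqr exprn_gt0.
have k0 : 0 <= k%:R :> R by exact: ler0n.
have E : k.+3%:R = k%:R + 3 :> R by rewrite -natrD addn3.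
rewrite /power_op E ler0_norm; last by rewrite mulrN oppr_le0 ltW// divr_gt0.
rewrite ler0_norm; last by lra.
rewrite (_ : _ + _ = c1 / 4 * (7 * eta - 1 - 2 * k%:R)); last by field.
by rewrite pmulr_rlt0 ?divr_gt0//; lra.
Qed.

Lemma power_sum_quarterE (R : realType) (n : nat) (c0 c1 : R) (x : 'rV[R]_n) :
  power_sum 0 c0 c1 (- 4^-1) 0 0 x = c0 + c1 / Num.sqrt (enorm x).
Proof.
by rewrite /power_sum mul0r addr0 subr0 powRN sqrt_enormE.
Qed.

(** Constants are not strict supersolutions, so [c] is perturbed by a multiple of [|y|^(-1/2)],
    normalized to add exactly [e] at the point [x] under consideration. *)
Lemma max_principle_annulus (R : realType) (k : nat) (eta r1 r2 c : R)
    (w : 'rV[R]_k.+3 -> R) : eta * 7 < 1 -> 0 < r1 ->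
  solves_outside eta r1 w ->
  (forall x, enorm x = r1 -> w x <= c) ->
  (forall x, enorm x = r2 -> w x <= c) ->
  forall x, r1 <= enorm x -> enorm x <= r2 -> w x <= c.
Proof.
move=> eta7 r10 sol w1 w2 x x1 x2.
have sx : 0 < Num.sqrt (enorm x) by rewrite sqrtr_gt0 (lt_le_trans r10).
apply/ler_addgt0Pr => e e0.
have es : 0 < e * Num.sqrt (enorm x) by rewrite mulr_gt0.
pose phi := power_sum 0 c (e * Num.sqrt (enorm x)) (- 4^-1) 0 0 : 'rV[R]_k.+3 -> R.
have -> : c + e = phi x by rewrite /phi power_sum_quarterE mulfK// gt_eqF.
have phic y : c <= phi y.
  by rewrite /phi power_sum_quarterE lerDl mulr_ge0 ?invr_ge0 ?sqrtr_ge0// ltW.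
apply: (@comparison_annulus R _ r1 r2 w phi) => //.
- move=> y yr1 _; have [? _] := sol _ yr1; split => //.
  by apply: power_sum_continuous; rewrite subr0 -enorm_sqr exprn_gt0// (lt_le_trans r10).
- move=> y /ltW yr1 _; have [_ ?] := sol _ yr1; exists eta; split=> //.
  by apply: strict_super_quarter => //; rewrite (lt_le_trans r10).
- by move=> y /w1 /le_trans; apply.
- by move=> y /w2 /le_trans; apply.
Qed.

(** The barrier [m (1 - (r / |x|)^(1/2))] vanishes at radius [r], stays below [m], and equals
    [m / 2] at radius [4 r]. The bound is independent of [rho], so values on far spheres are
    controlled from a fixed one. *)
Lemma sphere_inf_le (R : realType) (k : nat) (eta r m rho : R)
    (u : 'rV[R]_k.+3 -> R) : eta * 7 < 1 -> 0 < r -> 0 < m ->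
  solves_outside eta r u -> (forall x, enorm x = r -> 0 <= u x) ->
  (forall x, enorm x = rho -> m <= u x) ->
  forall x, enorm x = 4 * r -> 4 * r <= rho -> m <= 2 * u x.
Proof.
move=> eta7 r0 m0 sol ur urho x xr rrho.
have sr : 0 < Num.sqrt r by rewrite sqrtr_gt0.
have msr : 0 < m * Num.sqrt r by rewrite mulr_gt0.
pose phi := power_sum 0 (- m) (m * Num.sqrt r) (- 4^-1) 0 0 : 'rV[R]_k.+3 -> R.
have H y : enorm y = 4 * r -> - 1 * u y + 0 <= phi y -> m <= 2 * u y.
  move=> yr; rewrite /phi power_sum_quarterE yr sqrtrM//.
  rewrite (_ : Num.sqrt 4 = 2); last first.
    by rewrite (_ : 4 = 2 ^+ 2) ?sqrtr_sqr ?ger0_norm//; ring.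
  rewrite (_ : _ / _ = m / 2); last by field; rewrite gt_eqF.
  by lra.
apply: (H _ xr); apply: (@comparison_annulus R _ r rho (fun y => - 1 * u y + 0) phi).
- move=> y yr1 _; have [? _] := sol _ yr1; split; first exact: affine_continuous.
  by apply: power_sum_continuous; rewrite subr0 -enorm_sqr exprn_gt0// (lt_le_trans r0).
- move=> y /ltW yr1 _; have [_ ?] := sol _ yr1; exists eta; split.
    exact: near_laplace_affine.
  by apply: strict_super_quarter => //; rewrite (lt_le_trans r0).
- move=> y yr; rewrite /phi power_sum_quarterE yr mulfK ?gt_eqF//.
  by have := ur _ yr; lra.
- move=> y yr; rewrite /phi power_sum_quarterE; have := urho _ yr.
  have : 0 <= m * Num.sqrt r / Num.sqrt (enorm y).
    by rewrite mulr_ge0 ?invr_ge0 ?sqrtr_ge0// ltW.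
  by lra.
- by rewrite xr; lra.
- by rewrite xr.
Qed.

Lemma ex_limit_at_infinity (R : realType) (k : nat) (eta r : R)
    (u : 'rV[R]_k.+3 -> R) :
  eta * 7 < 1 -> eta * k.+1.+4%:R < 1 -> 0 < r ->
  solves_outside eta r u -> (forall x, r <= enorm x -> 0 <= u x) ->
  exists l : R, forall e, 0 < e -> exists M, forall x, M <= enorm x ->
    `|u x - l| <= e.
Proof.
move=> eta7 etak r0 sol upos.
have eta2 : eta <= 2^-1 by lra.
have [kap k0 Hk] := harnack_sphere R k.+1.
have harnack rho (w : 'rV[R]_k.+3 -> R) : 4 * r <= rho -> solves_outside eta r w ->
    (forall x, rho / 4 <= enorm x -> 0 <= w x) ->
    forall x z, enorm x = rho -> enorm z = rho -> kap * w x <= w z.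
  move=> rrho solw wpos.
  have rho0 : 0 < rho by lra.
  have rrho4 : r <= rho / 4 by lra.
  exact: (Hk eta rho w eta2 etak rho0 (solves_outside_le rrho4 solw) wpos).
have [x0 x0r] := @enorm_surj R k.+2 (4 * r) (mulr_ge0 (ler0n R 4) (ltW r0)).
(* Harnack makes [kap * u x] a lower bound on the whole sphere through [x], and the preceding
   barrier compares it with [u x0]. *)
have u_le x : 4 * r <= enorm x -> u x <= 2 * u x0 / kap.
  move=> rx; have [ux|ux] := leP (u x) 0.
    apply: le_trans ux _; rewrite mulr_ge0 ?invr_ge0 ?(ltW k0)// mulr_ge0//.
    by apply: upos; rewrite x0r; lra.
  rewrite ler_pdivlMr// mulrC; apply: (@sphere_inf_le R k eta r _ (enorm x) u) => //.
  - by rewrite mulr_gt0.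
  - by move=> y yr; apply: upos; rewrite yr.
  - move=> y yx; apply: (harnack (enorm x)) => // z zx.
    by apply: upos; lra.
(* The eventual lower bounds of [u]; their supremum is the liminf at infinity. *)
pose S := [set c | exists M, forall x, M <= enorm x -> c <= u x].
have S0 : S 0 by exists r.
have Sub : ubound S (2 * u x0 / kap).
  move=> c [M cM].
  have M4 : 0 <= Num.max M (4 * r).
    by rewrite le_max; apply/orP; right; rewrite mulr_ge0// ltW.
  have [x xE] := @enorm_surj R k.+2 _ M4.
  apply: (@le_trans _ _ (u x)); [apply: cM|apply: u_le];
    by rewrite xE le_max lexx ?orbT.
have supS : has_sup S by split; [exists 0|exists (2 * u x0 / kap)].
pose l := sup S; exists l => e e0.
pose e1 := e / (1 + 2 / kap).
have B0 : 0 < 1 + 2 / kap by rewrite addr_gt0// divr_gt0.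
have e10 : 0 < e1 by rewrite divr_gt0.
have eE : e = e1 + 2 * e1 / kap.
  rewrite (_ : e1 + 2 * e1 / kap = e1 * (1 + 2 / kap)); last by ring.
  by rewrite /e1 divfK// gt_eqF.
have [c [M cM] lc] := sup_adherent e10 supS.
pose r1 := Num.max r M.
have r1r : r <= r1 by rewrite le_max lexx.
have r10 : 0 < r1 by apply: lt_le_trans r1r.
have r1u x : r1 <= enorm x -> 0 <= u x - (l - e1).
  move=> r1x; rewrite subr_ge0; apply: (le_trans (ltW lc)); apply: cM.
  by apply: le_trans r1x; rewrite le_max lexx orbT.
have frequently M' : exists2 x, M' <= enorm x & u x < l + e1.
  apply: contrapT => H; have : l + e1 <= l; last by lra.
  apply: (sup_upper_bound supS); exists M' => x M'x.
  by rewrite leNgt; apply/negP => ux; apply: H; exists x.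
(* [w] is nonnegative far out and below [2 e1] at points arbitrarily far away; Harnack extends this
   to [2 e1 / kap] on the spheres through these points. The value of [e1] makes the total error
   [e]. *)
pose w x := 1 * u x + - (l - e1).
have solw : solves_outside eta r w by exact: solves_outside_affine.
have sphere y : 4 * r1 <= enorm y -> u y < l + e1 ->
    forall x, enorm x = enorm y -> w x <= 2 * e1 / kap.
  move=> ry uy x xy; rewrite ler_pdivlMr// mulrC.
  apply: (@le_trans _ _ (w y)); last by rewrite /w; lra.
  apply: (harnack (enorm y)) => //; first by lra.
  by move=> z zy; rewrite /w mul1r; apply: r1u; lra.
have [y1 ry1 uy1] := frequently (4 * r1).
exists (enorm y1) => x xy1.
have [y2 ry2 uy2] := frequently (enorm x).
have : w x <= 2 * e1 / kap.
  apply: (@max_principle_annulus R k eta (enorm y1) (enorm y2)) => //.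
  - by apply: lt_le_trans ry1; lra.
  - by apply: solves_outside_le solw; lra.
  - exact: sphere.
  - by apply: sphere => //; lra.
have : 0 <= w x by rewrite /w mul1r; apply: r1u; lra.
rewrite /w ler_norml eE; have : 0 < 2 * e1 / kap by rewrite !mulr_gt0 ?invr_gt0.
by lra.
Qed.

(** * Decay rates by comparison with radial powers *)

Lemma powRN_small (R : realType) (g tau : R) : 0 < g -> 0 < tau ->
  exists2 M : R, 1 <= M & forall r, M <= r -> r `^ (- g) <= tau.
Proof.
move=> g0 tau0; exists (Num.max 1 (tau^-1 `^ g^-1)); first by rewrite le_max lexx.
move=> r; rewrite ge_max => /andP[r1 rt].
have r0 : 0 < r by apply: lt_le_trans r1.
rewrite powRN -[leRHS]invrK lef_pV2 ?posrE ?powR_gt0 ?invr_gt0//.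
have <- : (tau^-1 `^ g^-1) `^ g = tau^-1.
  by rewrite -powRrM mulVf ?gt_eqF// powRr1// invr_ge0 ltW.
by apply: ge0_ler_powR; rewrite ?nnegrE ?powR_ge0// ltW.
Qed.

(** With [n = k + 3], the Laplacian of [|x|^-(n-2-d)] is [- d (n-2-d)] times a power of [|x|]; this
    margin [d] absorbs the perturbation once [eta (n + 1) < d]. The barrier equals 1 at radius
    [r]. *)
Lemma decay_rate (R : realType) (k : nat) (d eta r : R) (w : 'rV[R]_k.+3 -> R) :
  0 < d -> d <= 2^-1 -> eta * k.+4%:R < d -> 0 < r ->
  solves_outside eta r w ->
  (forall x, enorm x = r -> w x <= 1) ->
  (forall e, 0 < e -> exists M, forall x, M <= enorm x -> w x <= e) ->
  forall x, r <= enorm x ->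
  w x <= r `^ (k.+1%:R - d) * enorm x `^ (- (k.+1%:R - d)).
Proof.
move=> d0 d2 etad r0 sol w1 winf x rx.
pose e : R := - (k.+1%:R - d) / 2.
have k1 : 1 <= k.+1%:R :> R by rewrite ler1n.
pose phi := power_sum 0 0 (r `^ (k.+1%:R - d)) e 0 0 : 'rV[R]_k.+3 -> R.
have phiE y : phi y = r `^ (k.+1%:R - d) * enorm y `^ (- (k.+1%:R - d)).
  rewrite /phi /power_sum mul0r addr0 add0r subr0 nsq_powR.
  by rewrite (_ : 2 * e = - (k.+1%:R - d)) // /e; field.
rewrite -phiE; apply: (@comparison_outside R _ r w phi) => //.
- move=> y ry; have [? _] := sol _ ry; split=> //.
    by apply: power_sum_continuous; rewrite subr0 -enorm_sqr exprn_gt0// (lt_le_trans r0).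
  by rewrite phiE mulr_ge0 ?powR_ge0.
- move=> y ry; have [_ ?] := sol _ ry; exists eta; split=> //.
  have y0 : 0 < nsq (y - 0) by rewrite subr0 -enorm_sqr exprn_gt0// (lt_le_trans r0).
  apply: strict_super_power_sum => //.
  rewrite power_op0 mul0r addr0.
  rewrite pmulr_llt0 ?powR_gt0//.
  have rd : 0 < r `^ (k.+1%:R - d) by rewrite powR_gt0.
  have e0 : e < 0 by rewrite /e; lra.
  have E : k.+3%:R = k.+1%:R + 2 :> R by rewrite -natrD addn2.
  have E4 : k.+4%:R = k.+1%:R + 3 :> R by rewrite -natrD addn3.
  rewrite E4 in etad.
  rewrite /power_op E ler0_norm; last by rewrite pmulr_rle0// ltW.
  rewrite ler0_norm; last by lra.
  rewrite (_ : _ + _ = r `^ (k.+1%:R - d) * (- e) *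
     (2 * (eta * (k.+1%:R - d + 3) - d))); last by rewrite /e; field.
  rewrite pmulr_rlt0 ?pmulr_rlt0//; last by rewrite mulr_gt0// oppr_gt0.
  rewrite subr_lt0; have [eta0|eta0] := leP eta 0.
    apply: le_lt_trans d0; apply: mulr_le0_ge0 => //; lra.
  apply: le_lt_trans etad; apply: ler_wpM2l; first exact: ltW.
  by lra.
- move=> y yr; rewrite phiE yr -powRD ?subrr ?powRr0; first exact: w1.
  by apply/implyP => _; rewrite gt_eqF.
Qed.

(** Let [t = |x|^(-al/2)]. The leading power is harmonic, so it leaves only an error of relative
    order [t^2]; the subtracted power contributes a negative term of order [t], which wins far
    out. *)
Lemma decay_rate_critical (R : realType) (k : nat) (al C r : R)
    (w : 'rV[R]_k.+3 -> R) : 0 < al -> 0 < C ->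
  (forall x, r <= enorm x -> {for x, continuous w} /\
     near_laplace (C * enorm x `^ (- al)) w x) ->
  (forall e, 0 < e -> exists M, forall x, M <= enorm x -> w x <= e) ->
  exists C' M, forall x, M <= enorm x -> w x <= C' / enorm x ^+ k.+1.
Proof.
move=> al0 C0 sol winf.
pose g := al / 2; have g0 : 0 < g by rewrite divr_gt0.
pose e1 : R := - k.+1%:R / 2; pose e2 : R := e1 - g / 2.
have k1 : 1 <= k.+1%:R :> R by rewrite ler1n.
have e10 : e1 < 0 by rewrite /e1; lra.
have e20 : e2 < 0 by rewrite /e2; lra.
pose A1 := `|e1| * (4 * `|e1 - 1| + 2); pose A2 := `|e2| * (4 * `|e2 - 1| + 2).
have A10 : 0 < A1 by rewrite mulr_gt0 ?normr_gt0 ?lt_eqF// ltr_wpDl// mulr_ge0.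
have A20 : 0 < A2 by rewrite mulr_gt0 ?normr_gt0 ?lt_eqF// ltr_wpDl// mulr_ge0.
(* The second entry lets the order [t] term beat both errors; the entry [1/2] keeps [phi] at least
   half of its leading term. *)
pose tau := Num.min 2^-1 (- e2 * g / (C * (A1 + A2))).
have tau0 : 0 < tau.
  by rewrite lt_min invr_gt0// ltr0n/= divr_gt0// mulr_gt0// ?oppr_gt0// addr_gt0.
have [M0 M01 HM0] := powRN_small g0 tau0.
have [M1 wM1] := winf 1 ltr01.
pose M := Num.max (Num.max r M0) M1.
have Mr x : M <= x -> [/\ r <= x, M0 <= x & M1 <= x].
  by rewrite !ge_max => /andP[/andP[? ?] ?].
have M1' : 1 <= M by have [_ ? _] := Mr _ (lexx M); lra.
have M0' : 0 < M by lra.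
(* The factor 2 offsets that half: [phi >= 1 >= w] on the sphere of radius [M]. *)
pose D := 2 * M ^+ k.+1; have D0 : 0 < D by rewrite mulr_gt0// exprn_gt0.
pose phi := power_sum 0 0 D e1 (- D) e2 : 'rV[R]_k.+3 -> R.
have phiE y : 0 < enorm y ->
    phi y = D / enorm y ^+ k.+1 * (1 - enorm y `^ (- g)).
  move=> y0; rewrite /phi /power_sum add0r subr0 !nsq_powR.
  rewrite (_ : 2 * e2 = - k.+1%:R + - g); last by rewrite /e2 /e1; field.
  rewrite powRD; last by apply/implyP => _; rewrite gt_eqF.
  rewrite (_ : 2 * e1 = - k.+1%:R); last by rewrite /e1; field.
  by rewrite powR_invn ?enorm_ge0//; ring.
have half (y : 'rV[R]_k.+3) : M <= enorm y -> enorm y `^ (- g) <= 2^-1.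
  by move=> /Mr[_ /HM0 H _]; apply: le_trans H _; rewrite ge_min lexx.
exists D, M => x Mx.
have x0 : 0 < enorm x by lra.
apply: (@le_trans _ _ (phi x)); last first.
  rewrite phiE//; apply: ler_piMr; last by rewrite gerBl powR_ge0.
  by rewrite mulr_ge0 ?invr_ge0 ?exprn_ge0 ?enorm_ge0// ltW.
apply: (@comparison_outside R _ M w phi) => //.
- move=> y My; have y0 : 0 < enorm y by lra.
  have [ry _ _] := Mr _ My; have [? _] := sol _ ry; split=> //.
    by apply: power_sum_continuous; rewrite subr0 -enorm_sqr exprn_gt0.
  rewrite phiE// mulr_ge0//; last by have := half _ My; lra.
  by rewrite mulr_ge0 ?invr_ge0 ?exprn_ge0 ?enorm_ge0// ltW.
- move=> y My; have y0 : 0 < enorm y by lra.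
  have [ry M0y _] := Mr _ My; have [_ ?] := sol _ ry.
  exists (C * enorm y `^ (- al)); split=> //.
  have y1 : 0 < nsq (y - 0) by rewrite subr0 -enorm_sqr exprn_gt0.
  apply: strict_super_power_sum => //.
  set t := enorm y `^ (- g).
  have tt : enorm y `^ (- al) = t * t.
    rewrite -powRD; last by apply/implyP => _; rewrite gt_eqF.
    by congr powR; rewrite /g; field.
  have t0 : 0 < t by rewrite powR_gt0.
  have ttau : t <= tau by exact: HM0.
  have t2 : t <= 2^-1 by exact: half.
  have t3 : t * (C * (A1 + A2)) <= - e2 * g.
    rewrite -ler_pdivlMr; last by rewrite mulr_gt0// addr_gt0.
    by apply: le_trans ttau _; rewrite ge_min lexx orbT.
  have -> : nsq (y - 0) `^ (e2 - 1) = nsq (y - 0) `^ (e1 - 1) * t.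
    rewrite /t -[_ `^ (- g)](_ : nsq (y - 0) `^ (- g / 2) = _).
      rewrite -powRD; last by apply/implyP => _; rewrite gt_eqF.
      by congr powR; rewrite /e2; field.
    by rewrite nsq_powR subr0; congr powR; field.
  set s := nsq _ `^ _; have s0 : 0 < s by rewrite powR_gt0.
  rewrite /power_op (normrM D) (normrM (- D)) normrN (gtr0_norm D0) tt.
  rewrite (_ : _ + _ = D * s * t * (C * t * A1 + C * t * t * A2 + 2 * e2 * g)); last first.
    have E : k.+3%:R = k.+1%:R + 2 :> R by rewrite -natrD addn2.
    by rewrite /A1 /A2 E /e2 /e1; field.
  rewrite pmulr_rlt0; last by apply: mulr_gt0 => //; exact: mulr_gt0.
  have : C * t * t * A2 <= C * t * A2.
    rewrite ler_wpM2r ?(ltW A20)// ler_piMr ?mulr_ge0 ?(ltW t0) ?(ltW C0)//; lra.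
  have : 0 < - e2 * g by rewrite mulr_gt0// oppr_gt0.
  by lra.
- move=> y yM; have y0 : 0 < enorm y by lra.
  rewrite phiE// yM /D mulfK ?expf_neq0 ?gt_eqF//.
  have := half y; rewrite yM => /(_ (lexx _)).
  have [_ _ My1] := Mr _ (lexx M).
  by have := wM1 y; rewrite yM => /(_ My1); lra.
Qed.

(** * Linear change of variables *)

Lemma enorm_mulmx (R : realType) (n : nat) (V : 'M[R]_n) :
  exists2 c : R, 0 < c & forall x, enorm (x *m V) <= c * enorm x.
Proof.
pose B := \sum_j nsq (col j V)^T.
have B0 : 0 <= B by apply: sumr_ge0 => j _; exact: nsq_ge0.
exists (Num.sqrt (B + 1)); first by rewrite sqrtr_gt0 ltr_wpDl.
move=> x; rewrite !enormE -sqrtrM; last by rewrite addr_ge0.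
apply: ler_wsqrtr; apply: (@le_trans _ _ (B * nsq x)); last first.
  by apply: ler_wpM2r; rewrite ?nsq_ge0// lerDl.
rewrite nsqE mulr_suml; apply: ler_sum => j _.
rewrite mulrC (_ : (x *m V) ord0 j = dotr x (col j V)^T); first exact: dotr_sqr_le.
by rewrite dotrE mxE; apply: eq_bigr => i _; rewrite !mxE.
Qed.

Lemma continuous_comp_mulmx (R : realType) (n : nat) (W : 'M[R]_n)
    (v : 'rV[R]_n -> R) (y : 'rV[R]_n) : {for y *m W, continuous v} ->
  {for y, continuous (fun z : 'rV[R]_n => v (z *m W))}.
Proof.
move=> vc; apply: (@cvg_comp _ _ _ (fun z : 'rV[R]_n => z *m W) v _ (nbhs (y *m W))) vc.
have [c c0 Hc] := enorm_mulmx W.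
apply/(@cvgrPdist_lt _ _ _ (nbhs y) (nbhs_filter y)) => e e0.
have ec : 0 < e / c by rewrite divr_gt0.
have : enorm (y - y) < e / c by rewrite subrr enorm0.
move=> /near_enorm_lt; apply: filterS => z zy.
rewrite distrC -mulmxBl; apply: le_lt_trans (mx_norm_le_enorm _) _.
by apply: le_lt_trans (Hc _) _; rewrite mulrC -ltr_pdivlMr.
Qed.

Lemma qf_small (R : realType) (n : nat) (e : R) (M : 'M[R]_n) (w : 'rV[R]_n) :
  (forall i j, `|M i j| <= e) -> `|qf M w| <= e * n%:R * nsq w.
Proof.
move=> Me; rewrite qfE; apply: le_trans (ler_norm_sum _ _ _) _.
apply: (@le_trans _ _ (\sum_(i < n) \sum_(j < n)
    (e / 2 * w ord0 i ^+ 2 + e / 2 * w ord0 j ^+ 2))).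
  apply: ler_sum => i _; apply: le_trans (ler_norm_sum _ _ _) _.
  apply: ler_sum => j _; rewrite -mulrA normrM.
  have Me' := Me i j; have e0 : 0 <= e by apply: le_trans Me'.
  apply: le_trans (ler_wpM2r (normr_ge0 _) Me') _.
  rewrite -mulrDr -mulrA; apply: ler_wpM2l => //; rewrite normrM.
  rewrite -(real_normK (num_real (w ord0 i))) -(real_normK (num_real (w ord0 j))).
  have := sqr_ge0 (`|w ord0 i| - `|w ord0 j|); rewrite sqrrB -mulr_natr; lra.
rewrite (eq_bigr (fun i => n%:R * (e / 2 * w ord0 i ^+ 2) + e / 2 * nsq w)).
  rewrite big_split/= sumr_const card_ord -!mulr_sumr -nsqE -mulr_natr.
  by rewrite le_eqVlt; apply/orP; left; apply/eqP; field.
by move=> i _; rewrite big_split/= sumr_const card_ord -[_ *+ n]mulr_natl -mulr_sumr -nsqE.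
Qed.

Lemma qfD (R : realType) (n : nat) (A B : 'M[R]_n) (w : 'rV[R]_n) :
  qf (A + B) w = qf A w + qf B w.
Proof. by rewrite /qf mulmxDr mulmxDl mxE. Qed.

Lemma sum_qf_rows (R : realType) (n : nat) (H S : 'M[R]_n) :
  \sum_k qf H (row k S) = \tr (S *m H *m S^T).
Proof.
apply: eq_bigr => k _; rewrite /qf -row_mul tr_row.
by rewrite [RHS]mxE [LHS]mxE; apply: eq_bigr => j _; rewrite !mxE.
Qed.

Lemma positive_factor (R : realType) (n : nat) (A : 'M[R]_n) (l : R) :
  0 < l -> A^T = A -> (forall w, l * nsq w <= qf A w) ->
  exists2 W : 'M[R]_n, A = W^T *m W & W \in unitmx.
Proof.
move=> l0 As Ap.
have [w|W AW] := psd_factor As.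
  by apply: le_trans (Ap w); rewrite mulr_ge0 ?nsq_ge0// ltW.
exists W => //; rewrite -unitmx_tr -row_free_unit; apply: inj_row_free => w wW.
apply/eqP; rewrite -nsq_eq0 eq_le nsq_ge0 andbT -(pmulr_rle0 _ l0).
by apply: le_trans (Ap w) _; rewrite AW /qf !mulmxA wW !mul0mx mxE.
Qed.

(** In the coordinates [x = y *m W] the Hessian becomes [W *m H *m W^T], whose trace is that of
    [A *m H]. The constants [C] and [e0] are uniform in the point, and the linear dependence on [e]
    is what transports a power rate. *)
Lemma near_laplace_transform (R : realType) (n : nat) (D : set 'rV[R]_n)
    (a : 'rV[R]_n -> 'M[R]_n) (A W : 'M[R]_n) (v : 'rV[R]_n -> R) (l : R) :
  open D -> 0 < l -> symmetric_on D a -> classical_solution D a v ->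
  (forall w, l * nsq w <= qf A w) -> A = W^T *m W -> W \in unitmx ->
  exists C e0, [/\ 0 < C, 0 < e0 & forall e y, 0 <= e -> e <= e0 -> D (y *m W) ->
    (forall i j, `|a (y *m W) i j - A i j| <= e) ->
    near_laplace (C * e) (fun z => v (z *m W)) y].
Proof.
move=> oD l0 a_sym [vC2 veq] Al AW Wu.
have As : A^T = A by rewrite AW trmx_mul trmxK.
have [c c0 Hc] := enorm_mulmx (invmx W).
have trA : 0 <= \tr A.
  rewrite -qf_delta; apply: sumr_ge0 => i _; apply: le_trans (Al _).
  by rewrite mulr_ge0 ?nsq_ge0// ltW.
pose N : R := n%:R + 1; have N0 : 0 < N by rewrite ltr_wpDl.
have nN : n%:R <= N by rewrite lerDl.
exists (2 * c ^+ 2 * (N + N / l * \tr A)), (l / N / 2); split.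
- apply: mulr_gt0; first by apply: mulr_gt0 => //; exact: exprn_gt0.
  apply: ltr_pwDl => //; apply: mulr_ge0 => //; apply: ltW; exact: divr_gt0.
- by apply: divr_gt0 => //; exact: divr_gt0.
move=> e y e_ge0 ee0 Dx aA; set x := y *m W in Dx aA *.
pose eta := N * e / l.
have eta0 : 0 <= eta by rewrite divr_ge0 ?mulr_ge0// ltW.
have eta2 : eta <= 2^-1.
  rewrite ler_pdivrMr// mulrC -ler_pdivlMr//; apply: le_trans ee0 _.
  by rewrite le_eqVlt; apply/orP; left; apply/eqP; field; rewrite gt_eqF.
(* [a x = (1 - eta) A + M], where [eta] is just large enough for ellipticity of [A] to make [M]
   semidefinite. Dividing by [1 - eta >= 1/2] explains [s] below and the factor 2 in the
   constant. *)
pose M := (a x - A) + eta *: A.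
have Ms : M^T = M by rewrite /M linearD/= linearB/= linearZ/= As a_sym.
have [w|S0 MS] := psd_factor Ms.
  rewrite qfD qfZ; have := @qf_small R n e (a x - A) w.
  move=> /(_ _)-H; have {}H : `|qf (a x - A) w| <= e * n%:R * nsq w.
    by apply: H => i j; rewrite !mxE.
  have : eta * (l * nsq w) <= eta * qf A w by apply: ler_wpM2l.
  have : e * n%:R * nsq w <= e * N * nsq w.
    by apply: ler_wpM2r; [exact: nsq_ge0|exact: ler_wpM2l].
  rewrite (_ : eta * (l * nsq w) = e * N * nsq w); last first.
    by rewrite /eta; field; rewrite gt_eqF.
  by move: H; rewrite ler_norml; lra.
pose H : 'M[R]_n := \matrix_(i, j) partial i (partial j v) x.
pose s : R := Num.sqrt (1 - eta)^-1.
have s2 : s ^+ 2 = (1 - eta)^-1 by rewrite sqr_sqrtr// invr_ge0; lra.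
exists (W *m H *m W^T), (s *: (S0 *m invmx W)).
have WK : S0 *m invmx W *m W = S0 by rewrite mulmxKV.
have trM : \tr (S0 *m H *m S0^T) = - ((1 - eta) * \tr (W *m H *m W^T)).
  rewrite mxtrace_mulC mulmxA -MS /M mulmxDl mulmxBl -scalemxAl.
  rewrite mxtraceD raddfB/= mxtraceZ.
  have -> : \tr (A *m H) = \tr (W *m H *m W^T) by rewrite AW -mulmxA mxtrace_mulC.
  rewrite (_ : \tr (a x *m H) = 0); first by ring.
  rewrite -[RHS](veq _ Dx) exchange_big/=; apply: eq_bigr => i _.
  rewrite mxE; apply: eq_bigr => j _.
  by rewrite -[in LHS](a_sym _ Dx) !mxE.
split.
- move=> w; rewrite (_ : qf _ w = qf H (w *m W)); last first.
    by rewrite /qf trmx_mul !mulmxA.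
  rewrite (_ : (fun t => _) = (fun t : R => v (x + t *: (w *m W)))).
    exact: C2_sdiff2 oD vC2 Dx.
  by apply/funext => t; rewrite mulmxDl -scalemxAl.
- rewrite sum_qf_rows.
  have SW : s *: (S0 *m invmx W) *m W = s *: S0 by rewrite -scalemxAl WK.
  rewrite !mulmxA SW -(mulmxA (s *: S0 *m H)) -trmx_mul SW.
  rewrite (_ : (s *: S0)^T = s *: S0^T); last by rewrite linearZ.
  rewrite -!scalemxAl -scalemxAr !mxtraceZ mulrA -expr2 s2 trM.
  by rewrite mulrN mulKf ?subrr//; lra.
- rewrite (eq_bigr (fun k => s ^+ 2 * nsq (row k S0 *m invmx W))); last first.
    by move=> k _; rewrite linearZ/= nsqZ row_mul.
  rewrite -mulr_sumr s2.
  have trS : \sum_k nsq (row k S0) = \tr M.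
    rewrite MS mxtrace_mulC; apply: eq_bigr => k _; rewrite nsqE mxE.
    by apply: eq_bigr => j _; rewrite !mxE.
  have sumS : \sum_k nsq (row k S0 *m invmx W) <= c ^+ 2 * \tr M.
    rewrite -trS mulr_sumr; apply: ler_sum => k _.
    rewrite -!enorm_sqr -exprMn ler_pXn2r ?nnegrE ?mulr_ge0 ?enorm_ge0//.
    exact: ltW.
  have trMle : \tr M <= (N + N / l * \tr A) * e.
    rewrite /M mxtraceD mxtraceZ mulrDl (_ : N / l * \tr A * e = eta * \tr A); last first.
      by rewrite /eta; ring.
    rewrite lerD2r; apply: (@le_trans _ _ (n%:R * e)); last by apply: ler_wpM2r.
    rewrite -[n in n%:R]card_ord mulr_natl -sumr_const; apply: ler_sum => i _.
    by apply: le_trans (ler_norm _) _; rewrite !mxE.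
  have trM0 : 0 <= \tr M by rewrite -trS sumr_ge0// => k _; exact: nsq_ge0.
  apply: (@le_trans _ _ (2 * (c ^+ 2 * \tr M))).
    apply: ler_pM; rewrite ?invr_ge0 ?subr_ge0//; [lra| |].
      by apply: sumr_ge0 => k _; exact: nsq_ge0.
    by rewrite -[leRHS]invrK lef_pV2 ?posrE ?invr_gt0//; lra.
  rewrite -(mulrA 2) -(mulrA 2); apply: ler_wpM2l => //.
  by rewrite -(mulrA (c ^+ 2)); apply: ler_wpM2l => //; exact: sqr_ge0.
Qed.

Lemma open_outside (R : realType) (n : nat) :
  open (~` closed_unit_ball : set 'rV[R]_n).
Proof.
apply: closed_openC.
rewrite (_ : closed_unit_ball = @enorm R n @^-1` [set y | y <= 1])//.
by apply: closed_comp => [x _|]; [exact: enorm_continuous|exact: closed_le].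
Qed.

Lemma cvg_at_infinity_close (R : realType) (n : nat)
    (a : 'rV[R]_n -> 'M[R]_n) (A : 'M[R]_n) :
  (forall i j : 'I_n, a x i j @[x --> at_infinity] --> A i j) ->
  forall e, 0 < e -> exists M, forall x, M < enorm x ->
    forall i j, `|a x i j - A i j| <= e.
Proof.
move=> alim e e0.
have : at_infinity [set x | forall i j, `|a x i j - A i j| <= e].
  apply: (@filter_forall _ _ (fun i x => forall j, `|a x i j - A i j| <= e) at_infinity) => i.
  apply: (@filter_forall _ _ (fun j x => `|a x i j - A i j| <= e) at_infinity) => j.
  have /cvgrPdist_le/(_ _ e0) := alim i j.
  by apply: filterS => x; rewrite distrC.
by move=> [M _ HM]; exists M => x /HM.
Qed.

(** Symmetry and the lower ellipticity bound are closed conditions, and points of [D] exist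
    arbitrarily far out. *)
Lemma elliptic_limit (R : realType) (n : nat) (D : set 'rV[R]_n.+1)
    (a : 'rV[R]_n.+1 -> 'M[R]_n.+1) (A : 'M[R]_n.+1) (m : R) :
  (forall x, m < enorm x -> D x) ->
  symmetric_on D a -> uniformly_elliptic_on D a ->
  (forall i j, a x i j @[x --> at_infinity] --> A i j) ->
  A^T = A /\ exists2 l, 0 < l & forall w, l * nsq w <= qf A w.
Proof.
move=> mD asym [l [L [l0 lL ell]]] alim.
have close e : 0 < e -> exists x, D x /\ forall i j, `|a x i j - A i j| <= e.
  move=> /(cvg_at_infinity_close alim)[M HM].
  have p : 0 <= `|M| + `|m| + 1 by rewrite !addr_ge0.
  have [x xE] := @enorm_surj R n _ p.
  have := ler_norm M; have := ler_norm m; have := normr_ge0 M; have := normr_ge0 m.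
  by move=> *; exists x; split; [apply: mD|apply: HM]; rewrite xE; lra.
split.
  apply/matrixP => i j; rewrite mxE; apply/eqP; rewrite -subr_eq0 -normr_le0.
  apply/ler_addgt0Pr => e e0; have [|x [Dx xe]] := close (e / 2); first by rewrite divr_gt0.
  have := xe i j; have := xe j i; rewrite -{2}(asym _ Dx) mxE add0r.
  by rewrite !ler_norml; lra.
exists l => // w; apply/ler_addgt0Pr => e e0.
pose B : R := n.+1%:R * nsq w + 1.
have B0 : 0 < B by rewrite ltr_wpDl// mulr_ge0// nsq_ge0.
have [|x [Dx xe]] := close (e / B); first by rewrite divr_gt0.
have := ell x Dx w; rewrite -qfE enorm_sqr => /andP[+ _].
have := @qf_small R n.+1 (e / B) (a x - A) w.
rewrite -scaleN1r qfD qfZ => /(_ _)-H.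
have {}H : `|qf (a x) w + -1 * qf A w| <= e / B * n.+1%:R * nsq w.
  by apply: H => i j; rewrite scaleN1r !mxE.
have : e / B * n.+1%:R * nsq w <= e.
  by rewrite mulrAC -mulrA mulrAC ler_pdivrMr// ler_wpM2l ?(ltW e0)// mulrC lerDl.
by move: H; rewrite ler_norml; lra.
Qed.

Lemma powR_le_scale (R : realType) (s c x y : R) : 0 <= s -> 0 < c -> 0 < x ->
  x <= c * y -> y `^ (- s) <= c `^ s * x `^ (- s).
Proof.
move=> s0 c0 x0 xy; have y0 : 0 < y by rewrite -(pmulr_rgt0 _ c0) (lt_le_trans x0).
rewrite !powRN -[leLHS]mul1r ler_pdivrMr ?powR_gt0// mulrAC ler_pdivlMr ?powR_gt0//.
rewrite mul1r -(powRM _ (ltW c0) (ltW y0)).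
by apply: ge0_ler_powR => //; rewrite nnegrE ltW// mulr_gt0.
Qed.

(** The one-sided rates are applied to [u - l] and to [l - u], both affine in [u]. One [eta]
    depending on the dimension yields the limit; each [d] then takes its own smaller [eta] and
    larger radius. *)
Lemma asymptotics_normalized (R : realType) (k : nat) (u : 'rV[R]_k.+3 -> R) :
  (forall eta, 0 < eta -> exists r, solves_outside eta r u) ->
  (exists r, forall x, r <= enorm x -> 0 <= u x) ->
  exists l : R,
    (forall d, 0 < d -> d <= 2^-1 -> exists K M, forall x, M <= enorm x ->
       `|u x - l| <= K * enorm x `^ (- (k.+1%:R - d))) /\
    ((exists al C r, [/\ 0 < al, 0 < C & forall x, r <= enorm x ->
        {for x, continuous u} /\ near_laplace (C * enorm x `^ (- al)) u x]) ->
     exists K M, forall x, M <= enorm x -> `|u x - l| <= K / enorm x ^+ k.+1).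
Proof.
move=> sol [r1 upos].
have uE x l : u x - l = 1 * u x + - l by rewrite mul1r.
have uE' x l : - (u x - l) = - 1 * u x + l by ring.
have [eta [eta0 eta7 etak]] : exists eta : R, [/\ 0 < eta, eta * 7 < 1 &
    eta * k.+1.+4%:R < 1].
  have k0 : 0 <= k%:R :> R by exact: ler0n.
  have kE : k.+1.+4%:R = k%:R + 5 :> R by rewrite -(natrD R k 5) addnC.
  exists (k%:R + 8)^-1; split; first by rewrite invr_gt0; lra.
    by rewrite mulrC ltr_pdivrMr; lra.
  by rewrite mulrC kE ltr_pdivrMr; lra.
have [r0 sol0] := sol _ eta0.
pose r := Num.max 1 (Num.max r0 r1).
have rP x : r <= x -> [/\ 1 <= x, r0 <= x & r1 <= x].
  by rewrite !ge_max => /andP[? /andP[? ?]].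
have [r_1 r_r0 r_r1] := rP r (lexx _).
have [l lim_l] : exists l : R, forall e, 0 < e -> exists M, forall x, M <= enorm x ->
    `|u x - l| <= e.
  apply: (@ex_limit_at_infinity R k eta r u) => //; first by lra.
    exact: solves_outside_le sol0.
  by move=> x rx; apply: upos; lra.
have limD e : 0 < e -> exists M, forall x, M <= enorm x -> 1 * u x + - l <= e.
  move=> /lim_l[M HM]; exists M => x /HM; rewrite -uE; exact: le_trans (ler_norm _).
have limN e : 0 < e -> exists M, forall x, M <= enorm x -> - 1 * u x + l <= e.
  by move=> /lim_l[M HM]; exists M => x /HM; rewrite -uE' -normrN; exact: le_trans (ler_norm _).
exists l; split.
  move=> d d0 d2.
  have k4 : 0 < k.+4%:R :> R by rewrite ltr0n.
  have e0 : 0 < d / (2 * k.+4%:R) by rewrite divr_gt0// mulr_gt0.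
  have ek : d / (2 * k.+4%:R) * k.+4%:R < d.
    rewrite (_ : _ * _ = d / 2); first by lra.
    by field; rewrite -(natrD R 4) pnatr_eq0.
  have [r2 sol2] := sol _ e0; have [M HM] := lim_l 1 ltr01.
  pose M' := Num.max 1 (Num.max r2 M).
  have M'P x : M' <= x -> [/\ 1 <= x, r2 <= x & M <= x].
    by rewrite !ge_max => /andP[? /andP[? ?]].
  have [M'1 M'2 M'3] := M'P _ (lexx M'); have M'0 : 0 < M' by lra.
  have sol' := solves_outside_le M'2 sol2.
  exists (M' `^ (k.+1%:R - d)), M' => x Mx.
  have Hp := @decay_rate R k d _ M' _ d0 d2 ek M'0 (solves_outside_affine 1 (- l) sol') _ limD x Mx.
  have Hn := @decay_rate R k d _ M' _ d0 d2 ek M'0 (solves_outside_affine (- 1) l sol') _ limN x Mx.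
  have bound y : enorm y = M' -> `|u y - l| <= 1 by move=> yM; apply: HM; rewrite yM.
  rewrite ler_norml lerNl uE' uE; apply/andP; split.
    by apply: Hn => y /bound; rewrite -uE' -normrN; exact: le_trans (ler_norm _).
  by apply: Hp => y /bound; rewrite -uE; exact: le_trans (ler_norm _).
move=> [al [C [r2 [al0 C0 Hal]]]].
have [|K1 [M1 H1]] := @decay_rate_critical R k al C r2 _ al0 C0 _ limD.
  move=> x /Hal[? ?]; split; [exact: affine_continuous|exact: near_laplace_affine].
have [|K2 [M2 H2]] := @decay_rate_critical R k al C r2 _ al0 C0 _ limN.
  move=> x /Hal[? ?]; split; [exact: affine_continuous|exact: near_laplace_affine].
exists (Num.max K1 K2), (Num.max M1 M2) => x; rewrite ge_max => /andP[xM1 xM2].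
rewrite ler_norml lerNl uE' uE; apply/andP; split.
  apply: le_trans (H2 _ xM2) _; apply: ler_wpM2r; last by rewrite le_max lexx orbT.
  by rewrite invr_ge0 exprn_ge0// enorm_ge0.
apply: le_trans (H1 _ xM1) _; apply: ler_wpM2r; last by rewrite le_max lexx.
by rewrite invr_ge0 exprn_ge0// enorm_ge0.
Qed.

(** * Return to the original coordinates *)

Lemma at_infinityP (R : realType) (n : nat) (P : set 'rV[R]_n) (M : R) :
  (forall x, M < enorm x -> P x) -> \forall x \near at_infinity, P x.
Proof. by move=> H; exists M. Qed.

Theorem theorem2p2 (R : realType) (n : nat) (hn : (3 <= n)%N)
    (a : 'rV[R]_n -> 'M[R]_n) (ainf : 'M[R]_n) (v : 'rV[R]_n -> R)
    (a_sym : symmetric_on (~` closed_unit_ball) a)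
    (a_ell : uniformly_elliptic_on (~` closed_unit_ball) a)
    (a_lim : forall i j : 'I_n,
      a x i j @[x --> at_infinity] --> ainf i j)
    (v_sol : classical_solution (~` closed_unit_ball) a v)
    (v_pos : forall x, (~` closed_unit_ball) x -> 0 < v x) :
  exists vinf : R,
    (forall delta : R, 0 < delta ->
       v = cst vinf +o_at_infinity
             (fun x => 1 / enorm x `^ (n%:R - 2 - delta))) /\
    ((exists C alpha : R, [/\ 0 < C, 0 < alpha &
        forall x, (~` unit_ball) x -> forall i j : 'I_n,
          `|a x i j - ainf i j| <= C / enorm x `^ alpha]) ->
     v = cst vinf +O_at_infinity (fun x => 1 / enorm x ^+ (n - 2)%N)).
Proof.
destruct n as [|[|[|k]]] => // {hn}.
have outD (x : 'rV[R]_k.+3) : 1 < enorm x -> (~` closed_unit_ball) x.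
  by move=> x1; apply/negP; rewrite -ltNge.
have [As [l l0 Al]] := elliptic_limit outD a_sym a_ell a_lim.
have [W AW Wu] := positive_factor l0 As Al.
have [C1 [e0 [C10 e00 Htr]]] :=
  near_laplace_transform (@open_outside R k.+3) l0 a_sym v_sol Al AW Wu.
have [c c0 Hc] := enorm_mulmx (invmx W).
have [c' c'0 Hc'] := enorm_mulmx W.
have yle y : enorm y <= c * enorm (y *m W) by have := Hc (y *m W); rewrite mulmxK.
have xle x : enorm x <= c' * enorm (x *m invmx W).
  by have := Hc' (x *m invmx W); rewrite mulmxKV.
pose u y := v (y *m W).
have uV x : u (x *m invmx W) = v x by rewrite /u mulmxKV.
have large M y : c * (Num.max M 1 + 1) <= enorm y ->
    [/\ 1 < enorm (y *m W), M < enorm (y *m W) & (~` closed_unit_ball) (y *m W)].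
  move=> /le_trans/(_ (yle y)); rewrite ler_pM2l// => H.
  have : Num.max M 1 < enorm (y *m W) by lra.
  by rewrite gt_max => /andP[M1 H1]; split=> //; exact: outD.
have ucont y : (~` closed_unit_ball) (y *m W) -> {for y, continuous u}.
  by move=> /(v_sol.1)[vc _ _]; exact: continuous_comp_mulmx.
have sol eta : 0 < eta -> exists r, solves_outside eta r u.
  move=> eta0; pose e := Num.min e0 (eta / C1).
  have ep : 0 < e by rewrite lt_min e00 divr_gt0.
  have [M HM] := cvg_at_infinity_close a_lim ep.
  exists (c * (Num.max M 1 + 1)) => y /large[y1 yM yD]; split; first exact: ucont.
  apply: near_laplace_le (Htr e y _ _ yD (HM _ yM)); last 2 first.
  - exact: ltW.
  - by rewrite ge_min lexx.
  by rewrite mulrC -ler_pdivlMr// ge_min lexx orbT.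
have upos : exists r, forall y, r <= enorm y -> 0 <= u y.
  by exists (c * (Num.max 1 1 + 1)) => y /large[_ _ /v_pos/ltW].
have [vinf [HA HB]] := asymptotics_normalized sol upos.
exists vinf; split=> [delta delta0|[C [alpha [C0 alpha0 Hal]]]].
  apply/eqaddoP => e ep.
  (* The big-O rate for a strictly smaller [d] leaves a spare factor [|x|^-(delta - d)], which tends
     to 0 and gives the little-o. *)
  pose d := Num.min delta 1 / 2.
  have m0 : 0 < Num.min delta 1 by rewrite lt_min delta0 ltr01.
  have d0 : 0 < d by rewrite divr_gt0.
  have mdel : Num.min delta 1 <= delta by rewrite ge_min lexx.
  have m1 : Num.min delta 1 <= 1 by rewrite ge_min lexx orbT.
  have d2 : d <= 2^-1 by rewrite /d; lra.
  have dd : 0 < delta - d by rewrite /d; lra.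
  have k1 : 1 <= k.+1%:R :> R by rewrite ler1n.
  pose s : R := k.+1%:R - d; have s0 : 0 <= s by rewrite /s; lra.
  have [K [M HM]] := HA _ d0 d2.
  pose K' := `|K| * c' `^ s + 1.
  have K'0 : 0 < K' by rewrite ltr_wpDl// mulr_ge0// powR_ge0.
  have [M2 M21 HM2] := powRN_small dd (divr_gt0 ep K'0).
  apply: (@at_infinityP _ _ _ (Num.max M2 (c' * M))) => x.
  rewrite gt_max => /andP[xM2 xM].
  have x0 : 0 < enorm x by lra.
  have yM : M <= enorm (x *m invmx W).
    by rewrite -(ler_pM2l c'0); apply: le_trans (xle x); exact: ltW.
  have := HM _ yM; rewrite uV -/s => H.
  rewrite /= [X in `|X|](_ : _ = v x - vinf)//.
  have kE : k.+3%:R = k.+1%:R + 2 :> R by rewrite -(natrD R k.+1 2) addn2.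
  rewrite div1r -powRN (ger0_norm (powR_ge0 _ _)).
  apply: (le_trans H); apply: (@le_trans _ _ (K' * enorm x `^ (- s))).
    apply: (@le_trans _ _ (`|K| * (c' `^ s * enorm x `^ (- s)))).
      apply: (@le_trans _ _ (`|K| * enorm (x *m invmx W) `^ (- s))).
        by apply: ler_wpM2r; [exact: powR_ge0|exact: ler_norm].
      apply: ler_wpM2l; first exact: normr_ge0.
      exact: powR_le_scale s0 c'0 x0 (xle x).
    by rewrite mulrA; apply: ler_wpM2r; [exact: powR_ge0|rewrite lerDl].
  rewrite (_ : - s = - (delta - d) + - (k.+3%:R - 2 - delta)); last by rewrite kE /s; ring.
  rewrite powRD; last by apply/implyP => _; rewrite gt_eqF.
  rewrite mulrA; apply: ler_wpM2r; first exact: powR_ge0.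
  by rewrite mulrC -ler_pdivlMr//; apply: HM2; exact: ltW.
have [M1 M11 HM1] := powRN_small alpha0 (divr_gt0 e00 C0).
have [|K [M HM]] := HB.
  (* [|y| <= c |y W|] turns decay in [|x|] into decay in [|y|] at the cost of [c^alpha]; beyond [M1]
     the deviation is at most [e0], as the change of variables requires. *)
  exists alpha, (C1 * C * c `^ alpha), (c * (Num.max M1 1 + 1)); split=> //.
    by rewrite !mulr_gt0// powR_gt0.
  move=> y ry; have [y1 yM yD] := large _ _ ry; split; first exact: ucont.
  have y0 : 0 < enorm y.
    by apply: lt_le_trans ry; rewrite mulr_gt0// ltr_wpDl// le_max ler01 orbT.
  apply: near_laplace_le (Htr (C * enorm (y *m W) `^ (- alpha)) y _ _ yD _).
  - rewrite -!mulrA; do 2 (apply: ler_wpM2l; first exact: ltW).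
    by apply: powR_le_scale => //; exact: ltW.
  - by rewrite mulr_ge0 ?powR_ge0// ltW.
  - by rewrite mulrC -ler_pdivlMr//; apply: HM1; exact: ltW.
  - move=> i j; rewrite powRN; apply: Hal => /= H.
    by move: y1; rewrite ltNge ltW.
apply/eqaddOP; apply/bigO_exP.
exists (`|K| * c' ^+ k.+1 + 1); first by rewrite ltr_wpDl// mulr_ge0// exprn_ge0// ltW.
apply: (@at_infinityP _ _ _ (Num.max 1 (c' * M))) => x.
rewrite gt_max => /andP[x1 xM].
have x0 : 0 < enorm x by lra.
have yM : M <= enorm (x *m invmx W).
  by rewrite -(ler_pM2l c'0); apply: le_trans (xle x); exact: ltW.
have := HM _ yM; rewrite uV => H.
rewrite /= [X in `|X|](_ : _ = v x - vinf)// subSS subSS subn0.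
have y0 : 0 < enorm (x *m invmx W).
  by rewrite -(pmulr_rgt0 _ c'0); apply: lt_le_trans (xle x).
have xk : 0 < enorm x ^+ k.+1 by rewrite exprn_gt0.
have yk : 0 < enorm (x *m invmx W) ^+ k.+1 by rewrite exprn_gt0.
rewrite div1r (gtr0_norm (_ : 0 < (enorm x ^+ k.+1)^-1)) ?invr_gt0//.
apply: (le_trans H); apply: (@le_trans _ _ (`|K| * c' ^+ k.+1 / enorm x ^+ k.+1)).
  apply: (@le_trans _ _ (`|K| / enorm (x *m invmx W) ^+ k.+1)).
    by apply: ler_wpM2r; [rewrite invr_ge0 ltW|exact: ler_norm].
  rewrite -mulrA; apply: ler_wpM2l => //.
  rewrite ler_pdivlMr// mulrC ler_pdivrMr// -exprMn ler_pXn2r// nnegrE ?ltW//.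
  by rewrite mulr_gt0.
by apply: ler_wpM2r; [rewrite invr_ge0 ltW|rewrite lerDl].
Qed.
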